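(* Let $K$ be a field and let $KQ/\langle\rho\rangle$ be a finite-dimensional connected Koszul $K$-algebra, where $\rho$ is a set of quadratic relations. Let $F:(Q',\rho')\to(Q,\rho)$ be a Galois covering with finite Galois group $G$ satisfying $\mathrm{char}\,K\nmid|G|$. Then $KQ'/\langle\rho'\rangle$ is Koszul.
   Context: For a quiver $Q$, $Q_0$ and $Q_1$ are its sets of vertices and arrows, $KQ$ its path algebra, and $i(p)$, $t(p)$ the initial and terminal points of a path $p$. A quiver with relations $(Q,\rho)$ is a quiver $Q$ with a set $\rho$ of $K$-linear combinations of paths in $Q$; $\langle\rho\rangle$ is the (admissible) ideal of $KQ$ generated by $\rho$. Quadratic relations are $K$-linear combinations of paths of length 2. Connected means that the quiver $Q$ is connected. A graded $K$-algebra $E=\coprod_{i\ge0}E_i$ is generated in degree 0 and 1 if $E_i=E_1^i$ for all $i\ge2$. A graded quiver algebra is a graded $K$-algebra $A=\coprod_{i\geq 0}A_i$, generated in degree 0 and 1, with $A_0\cong K^r$ as $K$-algebras for some $r\ge1$ and $\dim_KA_i<\infty$ for all $i$; equivalently $A\cong KQ/I$ with $Q$ a finite quiver and $I$ an ideal, homogeneous in the length grading, contained in the square of the ideal generated by the arrows. A finite-dimensional (more generally noetherian semiperfect) $K$-algebra $A$ with Jacobson radical $J$ is quasi-Koszul if the Yoneda algebra $\mathrm{Ext}^*_A(A/J,A/J)=\coprod_{i\ge0}\mathrm{Ext}^i_A(A/J,A/J)$ (with Yoneda product) is generated in degree 0 and 1. A quasi-Koszul graded quiver algebra is called a Koszul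 algebra. Here the algebras carry the length grading. Coverings. Let $F:Q'\to Q$ be a covering of quivers (in the topological sense) and $v'\in Q'_0$. It is regular if $F_*(\pi_1(Q',v'))$ is a normal subgroup of $\pi_1(Q,F(v'))$; in this case $Q$ is homeomorphic to $Q'/G$, where $G\cong\pi_1(Q,F(v'))/F_*(\pi_1(Q',v'))$ is the automorphism group of the covering $F$. For $r=\sum_{i=1}^m k_ip_i$ a $K$-linear combination of paths and vertices $v,w$, the $(v,w)$-component $c_{v,w}(r)$ is the sum of those terms $k_ip_i$ for which $p_i$ has initial point $v$ and terminal point $w$. A lifting is a map $L:Q_0\to Q'_0$ with $L(v)\in F^{-1}(v)$ for all $v$; for a path $p$ in $Q$, $L(p)$ is the unique path in $Q'$ with initial point $L(i(p))$ and $F(L(p))=p$, and $L(\sum k_ip_i)=\sum k_iL(p_i)$. A morphism of quivers with relations $F:(Q',\rho')\to(Q,\rho)$ is a regular covering $F:Q'\to Q$ such that: (1) $\rho'=\{L(r)\mid L:Q_0\to Q'_0\text{ is a lifting and }r\in\rho\}$; (2) if $r'\in\rho'$ and $v,w\in Q_0$, then there exist $v',w'\in Q'_0$ with $F(c_{v',w'}(r'))=c_{v,w}(F(r'))$. If the automorphism group $G$ of the covering is finite, $F$ is called a Galois covering with finite Galois group $G$. *)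

(* Defs.v *)
From HB Require Import structures.
From mathcomp Require Import all_boot all_order all_algebra perm.
From mathcomp Require Import finmap boolp classical_sets monalg.

Set Implicit Arguments.
Unset Strict Implicit.
Unset Printing Implicit Defensive.
Import GRing.Theory.
Local Open Scope ring_scope.
Local Open Scope quotient_scope.

(* A K-algebra is a ring with a central structure map; unlike MathComp's
   [algType], it may be zero, so that every two-sided ideal has a quotient. *)
Record kalg (K : fieldType) := KAlg {
  kalg_ring :> pzRingType;
  kscal : {rmorphism K -> kalg_ring};
  kscalC : forall a x, kscal a * x = x * kscal a
}.

Record submodule (R : pzRingType) (V : lmodType R) := Submodule {
  in_submod :> V -> Prop;
  submod0 : in_submod 0;
  submodD : forall x y, in_submod x -> in_submod y -> in_submod (x + y);
  submodZ : forall a x, in_submod x -> in_submod (a *: x)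
}.

Section QuotientModule.
Variables (R : pzRingType) (V : lmodType R) (N : submodule V).

Definition submod_pred : pred V := fun x => `[< N x >].

Lemma submod_predP x : reflect (N x) (x \in submod_pred).
Proof. exact: asboolP. Qed.

Lemma submod_pred_zmod : zmod_closed submod_pred.
Proof.
split; first by apply/submod_predP; exact: submod0.
move=> x y /submod_predP Nx /submod_predP Ny; apply/submod_predP.
by apply: submodD => //; rewrite -scaleN1r; apply: submodZ.
Qed.

HB.instance Definition _ := GRing.isZmodClosed.Build V submod_pred
  submod_pred_zmod.

Definition submod_zmod : zmodClosed V := GRing.ZmodClosed.clone V submod_pred _.

Definition quotmod : Type := Quotient.quot submod_zmod.
HB.instance Definition _ := GRing.Zmodule.on quotmod.

Definition quotpi (x : V) : quotmod := \pi_(Quotient.quot submod_zmod) x.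

Lemma quotpi_eq x y : quotpi x = quotpi y <-> N (x - y).
Proof.
split=> [/eqP|/submod_predP Nxy].
  by rewrite /quotpi -Quotient.idealrBE => /submod_predP.
by apply/eqP; rewrite /quotpi -Quotient.idealrBE.
Qed.

Lemma quotpi_surj (x : quotmod) : exists y, quotpi y = x.
Proof. by exists (repr (x : Quotient.quot submod_zmod)); exact: reprK. Qed.

Lemma quotpiD x y : quotpi (x + y) = quotpi x + quotpi y.
Proof. exact: (raddfD \pi_(Quotient.quot submod_zmod)). Qed.

Definition quot_scale (a : R) (x : quotmod) : quotmod :=
  quotpi (a *: repr (x : Quotient.quot submod_zmod)).

Lemma quot_scaleE a x : quot_scale a (quotpi x) = quotpi (a *: x).
Proof.
apply/quotpi_eq; rewrite -scalerBr; apply: submodZ; apply/quotpi_eq.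
by rewrite /quotpi reprK.
Qed.

Fact quot_scaleA a b x : quot_scale a (quot_scale b x) = quot_scale (a * b) x.
Proof. by have [y <-] := quotpi_surj x; rewrite !quot_scaleE scalerA. Qed.
Fact quot_scale1 : left_id 1 quot_scale.
Proof.
by move=> x; have [y <-] := quotpi_surj x; rewrite quot_scaleE scale1r.
Qed.
Fact quot_scaleDr : right_distributive quot_scale +%R.
Proof.
move=> a x y; have [{}x <-] := quotpi_surj x; have [{}y <-] := quotpi_surj y.
by rewrite -quotpiD !quot_scaleE scalerDr quotpiD.
Qed.
Fact quot_scaleDl x : {morph quot_scale^~ x : a b / a + b}.
Proof.
move=> a b; have [{}x <-] := quotpi_surj x.
by rewrite !quot_scaleE scalerDl quotpiD.
Qed.

HB.instance Definition _ := GRing.Zmodule_isLmodule.Build R quotmod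
  quot_scaleA quot_scale1 quot_scaleDr quot_scaleDl.

Lemma quotpiZ a x : quotpi (a *: x) = a *: quotpi x.
Proof. by rewrite -quot_scaleE. Qed.

Fact quotpi_linear : linear quotpi.
Proof. by move=> a x y; rewrite quotpiD quotpiZ. Qed.
HB.instance Definition _ := GRing.isLinear.Build R V quotmod _ quotpi
  quotpi_linear.

End QuotientModule.

Record ideal2 (A : pzRingType) := Ideal2 {
  in_ideal :> A -> Prop;
  ideal0 : in_ideal 0;
  idealD : forall x y, in_ideal x -> in_ideal y -> in_ideal (x + y);
  idealMl : forall a x, in_ideal x -> in_ideal (a * x);
  idealMr : forall a x, in_ideal x -> in_ideal (x * a)
}.

Section GeneratedIdeal.
Variables (A : pzRingType) (S : A -> Prop).

Definition in_gen_ideal (x : A) :=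
  forall I : ideal2 A, (forall y, S y -> I y) -> I x.

Fact gen_ideal0 : in_gen_ideal 0.
Proof. by move=> I _; apply: ideal0. Qed.
Fact gen_idealD x y : in_gen_ideal x -> in_gen_ideal y -> in_gen_ideal (x + y).
Proof. by move=> Ix Iy I SI; apply: idealD; [apply: Ix | apply: Iy]. Qed.
Fact gen_idealMl a x : in_gen_ideal x -> in_gen_ideal (a * x).
Proof. by move=> Ix I SI; apply: idealMl; apply: Ix. Qed.
Fact gen_idealMr a x : in_gen_ideal x -> in_gen_ideal (x * a).
Proof. by move=> Ix I SI; apply: idealMr; apply: Ix. Qed.

Definition gen_ideal : ideal2 A :=
  Ideal2 gen_ideal0 gen_idealD gen_idealMl gen_idealMr.

End GeneratedIdeal.

Section QuotientRing.
Variables (A : pzRingType) (I : ideal2 A).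

Definition ideal_submod : submodule A^o :=
  @Submodule A A^o I (ideal0 I) (@idealD _ I) (@idealMl _ I).

Definition quotring : Type := quotmod ideal_submod.
HB.instance Definition _ := GRing.Zmodule.on quotring.

Definition quotring_pi (x : A) : quotring := quotpi ideal_submod x.

Definition quotring_mul (x y : quotring) : quotring :=
  quotring_pi (repr (x : Quotient.quot (submod_zmod ideal_submod)) *
               repr (y : Quotient.quot (submod_zmod ideal_submod))).

Lemma quotring_pi_eq x y : quotring_pi x = quotring_pi y <-> I (x - y).
Proof. exact: quotpi_eq. Qed.
Lemma quotring_pi_surj (x : quotring) : exists y, quotring_pi y = x.
Proof. exact: (@quotpi_surj A A^o ideal_submod x). Qed.
Lemma quotring_piD x y : quotring_pi (x + y) = quotring_pi x + quotring_pi y.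
Proof. exact: quotpiD. Qed.

Lemma quotring_mulE x y :
  quotring_mul (quotring_pi x) (quotring_pi y) = quotring_pi (x * y).
Proof.
rewrite /quotring_mul; set x' := repr _; set y' := repr _.
have Ix : I (x' - x) by apply/quotring_pi_eq; exact: (reprK (_ : Quotient.quot _)).
have Iy : I (y' - y) by apply/quotring_pi_eq; exact: (reprK (_ : Quotient.quot _)).
apply/quotring_pi_eq.
have -> : x' * y' - x * y = x' * (y' - y) + (x' - x) * y.
  by rewrite mulrBr mulrBl addrA subrK.
by apply: idealD; [apply: idealMl | apply: idealMr].
Qed.

Fact quotring_mulA : associative quotring_mul.
Proof.
move=> x y z; have [{}x <-] := quotring_pi_surj x.
have [{}y <-] := quotring_pi_surj y; have [{}z <-] := quotring_pi_surj z.
by rewrite !quotring_mulE mulrA.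
Qed.
Fact quotring_mul1l : left_id (quotring_pi 1) quotring_mul.
Proof.
by move=> x; have [{}x <-] := quotring_pi_surj x; rewrite quotring_mulE mul1r.
Qed.
Fact quotring_mul1r : right_id (quotring_pi 1) quotring_mul.
Proof.
by move=> x; have [{}x <-] := quotring_pi_surj x; rewrite quotring_mulE mulr1.
Qed.
Fact quotring_mulDl : left_distributive quotring_mul +%R.
Proof.
move=> x y z; have [{}x <-] := quotring_pi_surj x.
have [{}y <-] := quotring_pi_surj y; have [{}z <-] := quotring_pi_surj z.
by rewrite -quotring_piD !quotring_mulE mulrDl quotring_piD.
Qed.
Fact quotring_mulDr : right_distributive quotring_mul +%R.
Proof.
move=> x y z; have [{}x <-] := quotring_pi_surj x.
have [{}y <-] := quotring_pi_surj y; have [{}z <-] := quotring_pi_surj z.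
by rewrite -quotring_piD !quotring_mulE mulrDr quotring_piD.
Qed.

HB.instance Definition _ := GRing.Zmodule_isPzRing.Build quotring
  quotring_mulA quotring_mul1l quotring_mul1r quotring_mulDl quotring_mulDr.

Fact quotring_pi_zmod : zmod_morphism quotring_pi.
Proof. by move=> x y; exact: (raddfB (quotpi ideal_submod)). Qed.
HB.instance Definition _ := GRing.isZmodMorphism.Build A quotring quotring_pi
  quotring_pi_zmod.

Fact quotring_pi_monoid : monoid_morphism quotring_pi.
Proof. by split=> // x y; rewrite -quotring_mulE. Qed.
HB.instance Definition _ := GRing.isMonoidMorphism.Build A quotring quotring_pi
  quotring_pi_monoid.

End QuotientRing.

Section QuotientAlgebra.
Variables (K : fieldType) (A : kalg K) (I : ideal2 A).

Fact quotalg_scalC (a : K) (x : quotring I) :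
  (quotring_pi I \o kscal A) a * x = x * (quotring_pi I \o kscal A) a.
Proof.
by have [y <-] := quotring_pi_surj x; rewrite /= -!rmorphM kscalC.
Qed.

Definition quotalg : kalg K :=
  @KAlg K (quotring I) (quotring_pi I \o kscal A) quotalg_scalC.

End QuotientAlgebra.

Definition maximal_left_ideal (A : pzRingType) (M : submodule A^o) : Prop :=
  ~ M 1 /\
  forall N : submodule A^o, (forall x, M x -> N x) ->
    N 1 \/ (forall x, N x -> M x).

Section Jacobson.
Variable A : pzRingType.

Definition in_jacobson (x : A^o) : Prop :=
  forall M : submodule A^o, maximal_left_ideal M -> M x.

Fact jacobson0 : in_jacobson 0.
Proof. by move=> M _; apply: submod0. Qed.
Fact jacobsonD x y : in_jacobson x -> in_jacobson y -> in_jacobson (x + y).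
Proof. by move=> Jx Jy M maxM; apply: submodD; [apply: Jx | apply: Jy]. Qed.
Fact jacobsonZ a x : in_jacobson x -> in_jacobson (a *: x).
Proof. by move=> Jx M maxM; apply: submodZ; apply: Jx. Qed.

Definition jacobson : submodule A^o :=
  Submodule jacobson0 jacobsonD jacobsonZ.

End Jacobson.

Definition projective (A : pzRingType) (P : lmodType A) : Prop :=
  forall (M N : lmodType A) (g : {linear M -> N}) (f : {linear P -> N}),
    (forall y, exists x, g x = y) ->
    exists h : {linear P -> M}, forall x, g (h x) = f x.

Record proj_resolution (A : pzRingType) (M : lmodType A) := ProjResolution {
  res_mod :> nat -> lmodType A;
  res_d : forall n, {linear res_mod n.+1 -> res_mod n};
  res_aug : {linear res_mod 0%N -> M};
  res_projective : forall n, projective (res_mod n);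
  res_aug_surj : forall y, exists x, res_aug x = y;
  res_exact0 : forall x, res_aug x = 0 <-> exists y, res_d 0 y = x;
  res_exact : forall n x, res_d n x = 0 <-> exists y, res_d n.+1 y = x
}.

Section Ext.
Variables (A : pzRingType) (M : lmodType A) (P : proj_resolution M).

(* Ext^n_A(M, M) = H^n(Hom_A(P, M)): its elements are represented by
   n-cocycles, two cocycles being identified when they differ by a
   coboundary. *)
Definition cocycle n (f : {linear P n -> M}) : Prop :=
  forall x, f (res_d P n x) = 0.

Definition cohomologous n : {linear P n -> M} -> {linear P n -> M} -> Prop :=
  match n with
  | 0%N => fun f g => f =1 g
  | m.+1 => fun f g =>
      exists h : {linear P m -> M}, forall x, f x = g x + h (res_d P m x)
  end.

(* [F] is a chain map P_{*+n} -> P_* lifting the cocycle [f : P_n -> M].  The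
   Yoneda product of the class of [g : P_m -> M] with that of [f] is then the
   class of [g \o F m : P_{m+n} -> M]. *)
Definition chain_lift n (f : {linear P n -> M})
    (F : forall k, {linear P (k + n)%N -> P k}) : Prop :=
  (forall x, res_aug P (F 0%N x) = f x) /\
  (forall k x, res_d P k (F k.+1 x) = F k (res_d P (k + n)%N x)).

(* [ext1_power n f]: for n >= 1, the class of [f] lies in the n-th power of
   E_1 = Ext^1, i.e., in the set of finite sums of n-fold Yoneda products of
   elements of E_1; this is a subspace, as E_1 is one. *)
Inductive ext1_power : forall n, {linear P n -> M} -> Prop :=
| Ext1PowerGen (f : {linear P 1%N -> M}) : cocycle f -> ext1_power f
| Ext1PowerMul n (g : {linear P 1%N -> M}) (f : {linear P n -> M})
    (F : forall k, {linear P (k + n)%N -> P k}) (h : {linear P n.+1 -> M}) :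
    cocycle g -> ext1_power f -> chain_lift f F ->
    (forall x, h x = g (F 1%N x)) -> ext1_power h
| Ext1PowerAdd n (f g h : {linear P n -> M}) :
    ext1_power f -> ext1_power g -> (forall x, h x = f x + g x) ->
    ext1_power h
| Ext1PowerCoh n (f g : {linear P n -> M}) :
    ext1_power f -> cohomologous g f -> ext1_power g.

End Ext.

(* Ext^*_A(M, M) and its product do not depend on the resolution. *)
Definition ext_generated_in_degrees_01 (A : pzRingType) (M : lmodType A) :=
  exists P : proj_resolution M,
    forall n (f : {linear P n -> M}), (2 <= n)%N -> cocycle f -> ext1_power f.

Definition fin_dim (K : fieldType) (A : kalg K) (S : A -> Prop) : Prop :=
  exists n (b : 'I_n -> A), forall x, S x ->
    exists c : 'I_n -> K, x = \sum_(i < n) kscal A (c i) * b i.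

Definition finite_dimensional (K : fieldType) (A : kalg K) : Prop :=
  fin_dim (fun _ : A => True).

(* J is the intersection of the maximal left ideals and A / J a left module. *)
Definition quasi_koszul (K : fieldType) (A : kalg K) : Prop :=
  finite_dimensional A /\ ext_generated_in_degrees_01 (quotmod (jacobson A)).

Record grading (K : fieldType) (A : kalg K) (gr : nat -> A -> Prop) : Prop :=
  Grading {
  gr0 : forall n, gr n 0;
  grD : forall n x y, gr n x -> gr n y -> gr n (x + y);
  grZ : forall n a x, gr n x -> gr n (kscal A a * x);
  gr_one : gr 0%N 1;
  grM : forall m n x y, gr m x -> gr n y -> gr (m + n)%N (x * y);
  gr_sum : forall x, exists N (f : nat -> A),
    (forall n, gr n (f n)) /\ x = \sum_(n < N) f n;
  gr_direct : forall N (f : nat -> A), (forall n, gr n (f n)) ->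
    \sum_(n < N) f n = 0 -> forall n, (n < N)%N -> f n = 0
}.

Definition generated_in_degrees_01 (K : fieldType) (A : kalg K)
    (gr : nat -> A -> Prop) : Prop :=
  forall n x, (2 <= n)%N -> gr n x ->
    exists m (a : 'I_m -> 'I_n -> A),
      (forall j k, gr 1%N (a j k)) /\ x = \sum_(j < m) \prod_(k < n) a j k.

Record graded_quiver_algebra (K : fieldType) (A : kalg K)
    (gr : nat -> A -> Prop) : Prop := GradedQuiverAlgebra {
  gqa_grading : grading gr;
  gqa_generated : generated_in_degrees_01 gr;
  (* A_0 is isomorphic to K^r as a K-algebra, with r = r'.+1 >= 1 *)
  gqa_degree0 : exists r' (f : {ffun 'I_r'.+1 -> K} -> A),
    [/\ forall (c : K) (x y : {ffun 'I_r'.+1 -> K}),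
          f ([ffun i => c * x i] + y) = kscal A c * f x + f y,
        f 1 = 1, {morph f : x y / x * y}, injective f &
        forall a, gr 0%N a <-> exists x, f x = a];
  gqa_fin_dim : forall n, fin_dim (gr n)
}.

Definition koszul (K : fieldType) (A : kalg K) (gr : nat -> A -> Prop) :=
  graded_quiver_algebra gr /\ quasi_koszul A.

(* Only finite quivers are considered; K Q has a unit exactly when the vertex
   set is finite. *)
Record quiver := Quiver {
  vert : finType;
  arr : finType;
  src : arr -> vert;
  tgt : arr -> vert
}.

Section Paths.
Variable Q : quiver.
Implicit Types (v : vert Q) (s : seq (arr Q)).

Fixpoint composable v s : bool :=
  if s is a :: s' then (src a == v) && composable (tgt a) s' else true.

Definition endpoint v s : vert Q := last v (map (@tgt Q) s).

Lemma composable_cat v s1 s2 :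
  composable v (s1 ++ s2) = composable v s1 && composable (endpoint v s1) s2.
Proof. by elim: s1 v => //= a s1 IH v; rewrite IH andbA. Qed.

Lemma endpoint_cat v s1 s2 :
  endpoint v (s1 ++ s2) = endpoint (endpoint v s1) s2.
Proof. by rewrite /endpoint map_cat last_cat. Qed.

Record qpath := QPath {
  qpath_val : vert Q * seq (arr Q);
  qpath_ok : composable qpath_val.1 qpath_val.2
}.
HB.instance Definition _ := [isSub for qpath_val].
HB.instance Definition _ := [Choice of qpath by <:].

Definition psrc (p : qpath) : vert Q := (qpath_val p).1.
Definition parr (p : qpath) : seq (arr Q) := (qpath_val p).2.
Definition ptgt (p : qpath) : vert Q := endpoint (psrc p) (parr p).
Definition plen (p : qpath) : nat := size (parr p).

Definition ptriv v : qpath := @QPath (v, [::]) isT.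

(* Diagrammatic order: first p, then q. *)
Definition pcomp (p q : qpath) : option qpath :=
  if ptgt p == psrc q then insub (psrc p, parr p ++ parr q) else None.

Lemma qpathP (p q : qpath) : psrc p = psrc q -> parr p = parr q -> p = q.
Proof.
case: p q => [[v s] p] [[w t] q]; rewrite /psrc /parr /= => evw est.
by apply: val_inj; rewrite /= evw est.
Qed.

Variant pcomp_spec p q : option qpath -> Prop :=
| PcompSome r of ptgt p = psrc q & psrc r = psrc p & parr r = parr p ++ parr q
    & ptgt r = ptgt q : pcomp_spec p q (Some r)
| PcompNone of ptgt p <> psrc q : pcomp_spec p q None.

Lemma pcompP p q : pcomp_spec p q (pcomp p q).
Proof.
rewrite /pcomp; case: eqP => [e|ne]; last exact: PcompNone.
have c : composable (psrc p, parr p ++ parr q).1 (psrc p, parr p ++ parr q).2.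
  rewrite /= composable_cat (qpath_ok p) /=.
  by move: (qpath_ok q); rewrite -/(psrc q) -/(parr q) -e.
rewrite insubT /=; apply: PcompSome => //=.
by rewrite /ptgt /psrc /parr /= endpoint_cat -/(psrc p) -/(parr p) -/(ptgt p) e.
Qed.

Lemma pcomp_trivl v p :
  pcomp (ptriv v) p = if v == psrc p then Some p else None.
Proof.
case: pcompP => [r|]; rewrite {1}/ptgt /= => e; last by case: eqP.
by move=> e1 e2 _; rewrite [v]e eqxx; congr Some; apply: qpathP; rewrite ?e2 ?e1.
Qed.

Lemma pcomp_trivr v p :
  pcomp p (ptriv v) = if v == ptgt p then Some p else None.
Proof.
case: pcompP => [r|]; rewrite {1}/psrc /= => e; last by case: eqP => // /esym.
move=> e1 e2 _; rewrite -e eqxx; congr Some; apply: qpathP => //.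
by rewrite e2 cats0.
Qed.

Lemma pcompA p q r :
  obind (fun x => pcomp x r) (pcomp p q) = obind (pcomp p) (pcomp q r).
Proof.
case: pcompP => [pq e1 e2 e3 e4|ne] /=; last first.
  by case: pcompP => [qr f1 f2 f3 f4|//] /=; case: pcompP => //; rewrite f2.
case: (pcompP pq r) => [x g1 g2 g3 g4|ne]; last first.
  by case: pcompP => //= qr f1; case: ne; rewrite e4.
case: pcompP => [qr f1 f2 f3 f4|] /=; last by rewrite -g1 e4.
case: pcompP => [y h1 h2 h3 h4|]; last by rewrite f2.
by congr Some; apply: qpathP; rewrite ?g2 ?e2 ?h2 // g3 e3 h3 f3 catA.
Qed.

End Paths.

Section LinearExtension.
Variables (K : fieldType) (T : choiceType) (V : lmodType K).
Implicit Types (f : T -> V) (x y : {malg K[T]}).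

Definition linext f x : V := (\sum_(p <- msupp x) x@_p *: f p)%R.

Lemma linextw f x (d : {fset T}) : (msupp x `<=` d)%fset ->
  linext f x = \sum_(p <- d) x@_p *: f p.
Proof.
move=> le; rewrite /linext (big_fset_incl _ le) //= => p _ /mcoeff_outdom ->.
by rewrite scale0r.
Qed.

Fact linext_linear f : linear (linext f).
Proof.
move=> a x y; have l1 := fsubsetUl (msupp x) (msupp y).
have l2 := fsubsetUr (msupp x) (msupp y).
rewrite (linextw _ l1) (linextw _ l2) (@linextw _ _ (msupp x `|` msupp y)%fset).
  rewrite scaler_sumr -big_split; apply: eq_bigr => p _ /=.
  by rewrite mcoeffD mcoeffZ scalerDl scalerA.
apply: fsubset_trans (msuppD_le _ _) _; apply: fsetSU; exact: msuppZ_le.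
Qed.
HB.instance Definition _ f := GRing.isLinear.Build K {malg K[T]} V _ (linext f)
  (linext_linear f).

Lemma linextU f p : linext f << p >> = f p.
Proof.
by rewrite (linextw _ (msuppU_le)) big_seq_fset1 mcoeffUU scale1r.
Qed.

Lemma eq_linext f g x : f =1 g -> linext f x = linext g x.
Proof. by move=> fg; apply: eq_bigr => p _; rewrite fg. Qed.

Lemma linextDf f g x : linext (fun p => f p + g p) x = linext f x + linext g x.
Proof. by rewrite -big_split; apply: eq_bigr => p _; rewrite scalerDr. Qed.

Lemma linextZf a f x : linext (fun p => a *: f p) x = a *: linext f x.
Proof.
by rewrite scaler_sumr; apply: eq_bigr => p _; rewrite !scalerA mulrC.
Qed.

Lemma malg_linE x : x = \sum_(p <- msupp x) x@_p *: << p >>.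
Proof.
rewrite {1}[x]monalgE; apply: eq_bigr => p _; apply/malgP => q.
by rewrite mcoeffZ !mcoeffU mulr_natr.
Qed.

Lemma linear_malg_eq (f g : {linear {malg K[T]} -> V}) :
  (forall p, f << p >> = g << p >>) -> f =1 g.
Proof.
move=> fg x; rewrite [x]malg_linE !linear_sum; apply: eq_bigr => p _.
by rewrite !linearZ fg.
Qed.

End LinearExtension.

Section PathAlgebra.
Variables (K : fieldType) (Q : quiver).

Definition pathalg : Type := {malg K[qpath Q]}.
HB.instance Definition _ := GRing.Lmodule.on pathalg.

Definition pbasis (p : qpath Q) : pathalg := << p >>.

Definition obasis (o : option (qpath Q)) : pathalg :=
  if o is Some p then pbasis p else 0.

Definition pmul (x y : pathalg) : pathalg :=
  linext (fun p => linext (fun q => obasis (pcomp p q)) y) x.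

Definition pone : pathalg := \sum_(v : vert Q) pbasis (ptriv v).

Lemma pmulDl : left_distributive pmul +%R.
Proof. by move=> x y z; rewrite /pmul linearD. Qed.

Lemma pmulZl a x y : pmul (a *: x) y = a *: pmul x y.
Proof. by rewrite /pmul linearZ. Qed.

Lemma pmulDr : right_distributive pmul +%R.
Proof.
move=> x y z; rewrite /pmul -linextDf; apply: eq_linext => p.
by rewrite linearD.
Qed.

Lemma pmulZr a x y : pmul x (a *: y) = a *: pmul x y.
Proof.
rewrite /pmul -linextZf; apply: eq_linext => p.
by rewrite linearZ.
Qed.

Lemma pmulU p q : pmul (pbasis p) (pbasis q) = obasis (pcomp p q).
Proof. by rewrite /pmul !linextU. Qed.

Fact pmull_linear y : linear (pmul^~ y).
Proof. by move=> a x x'; rewrite pmulDl pmulZl. Qed.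
Fact pmulr_linear x : linear (pmul x).
Proof. by move=> a y y'; rewrite pmulDr pmulZr. Qed.

Lemma pathalg_ext (V : lmodType K) (f g : pathalg -> V) :
  linear f -> linear g -> (forall p, f (pbasis p) = g (pbasis p)) -> f =1 g.
Proof.
move=> lf lg fg.
pose F := GRing.isLinear.Build K pathalg V _ f lf.
pose G := GRing.isLinear.Build K pathalg V _ g lg.
pose f' : {linear pathalg -> V} := HB.pack f F.
pose g' : {linear pathalg -> V} := HB.pack g G.
exact: (@linear_malg_eq K _ V f' g').
Qed.

Lemma pmul0 x : pmul x 0 = 0.
Proof. by have := pmulZr 0 x 0; rewrite !scale0r. Qed.
Lemma pmul0l x : pmul 0 x = 0.
Proof. by have := pmulZl 0 0 x; rewrite !scale0r. Qed.

Fact pmulA : associative pmul.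
Proof.
move=> x y z; move: x; apply: pathalg_ext => [a x x'|a x x'|p].
- by rewrite pmulDl pmulZl.
- by rewrite !(pmulDl, pmulZl).
move: y; apply: pathalg_ext => [a y y'|a y y'|q].
- by rewrite !(pmulDl, pmulZl, pmulDr, pmulZr).
- by rewrite !(pmulDl, pmulZl, pmulDr, pmulZr).
move: z; apply: pathalg_ext => [a z z'|a z z'|r].
- by rewrite !(pmulDr, pmulZr).
- by rewrite !(pmulDr, pmulZr).
have opl o : pmul (obasis o) (pbasis r) = obasis (obind (fun p => pcomp p r) o).
  by case: o => [s|] /=; rewrite ?pmulU // pmul0l.
have opr o : pmul (pbasis p) (obasis o) = obasis (obind (pcomp p) o).
  by case: o => [s|] /=; rewrite ?pmulU // pmul0.
by rewrite !pmulU opl opr pcompA.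
Qed.

Lemma pmul_suml (I : Type) (s : seq I) (F : I -> pathalg) y :
  pmul (\sum_(i <- s) F i) y = \sum_(i <- s) pmul (F i) y.
Proof. by apply: (big_morph (pmul^~ y)) => [a b|]; rewrite ?pmulDl ?pmul0l. Qed.
Lemma pmul_sumr (I : Type) (s : seq I) (F : I -> pathalg) x :
  pmul x (\sum_(i <- s) F i) = \sum_(i <- s) pmul x (F i).
Proof. by apply: (big_morph (pmul x)) => [a b|]; rewrite ?pmulDr ?pmul0. Qed.

Fact pmul1l : left_id pone pmul.
Proof.
apply: pathalg_ext => [a x y|//|p]; first by rewrite pmulDr pmulZr.
rewrite pmul_suml (bigD1 (psrc p)) //= pmulU pcomp_trivl eqxx /= big1 ?addr0 //.
by move=> v /negPf nv; rewrite pmulU pcomp_trivl nv.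
Qed.
Fact pmul1r : right_id pone pmul.
Proof.
apply: pathalg_ext => [a x y|//|p]; first by rewrite pmulDl pmulZl.
rewrite pmul_sumr (bigD1 (ptgt p)) //= pmulU pcomp_trivr eqxx /= big1 ?addr0 //.
by move=> v /negPf nv; rewrite pmulU pcomp_trivr nv.
Qed.

HB.instance Definition _ := GRing.Zmodule_isPzRing.Build pathalg
  pmulA pmul1l pmul1r pmulDl pmulDr.

Definition pscal (a : K) : pathalg := a *: (1 : pathalg).

Lemma pscalE a (x : pathalg) : pscal a * x = a *: x.
Proof. by rewrite -[RHS](congr1 _ (mul1r x)); exact: pmulZl. Qed.

Fact pscal_zmod : zmod_morphism pscal.
Proof. by move=> a b; rewrite /pscal scalerBl. Qed.
Fact pscal_monoid : monoid_morphism pscal.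
Proof. by split=> [|a b]; rewrite ?pscalE /pscal ?scale1r ?scalerA. Qed.
HB.instance Definition _ := GRing.isZmodMorphism.Build K pathalg pscal
  pscal_zmod.
HB.instance Definition _ := GRing.isMonoidMorphism.Build K pathalg pscal
  pscal_monoid.

Fact pscalC a (x : pathalg) : pscal a * x = x * pscal a.
Proof. by rewrite pscalE -[LHS](congr1 _ (mulr1 x)); symmetry; exact: pmulZr. Qed.

Definition path_kalg : kalg K := @KAlg K pathalg pscal pscalC.

End PathAlgebra.

Definition quiver_alg (K : fieldType) (Q : quiver)
    (rho : pathalg K Q -> Prop) : kalg K :=
  quotalg (A := path_kalg K Q) (gen_ideal rho).

Definition homogeneous (K : fieldType) (Q : quiver) (n : nat)
    (x : pathalg K Q) : Prop :=
  forall p, p \in msupp x -> plen p = n.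

Definition quadratic (K : fieldType) (Q : quiver)
    (rho : pathalg K Q -> Prop) : Prop :=
  forall r, rho r -> homogeneous 2 r.

Definition length_grading (K : fieldType) (Q : quiver)
    (rho : pathalg K Q -> Prop) (n : nat) (a : quiver_alg rho) : Prop :=
  exists2 x : pathalg K Q, homogeneous n x &
    a = quotring_pi (gen_ideal rho) x.

Section Walks.
Variable Q : quiver.

(* (a, true) is the arrow a, and (a, false) its formal inverse. *)
Definition step : Type := (arr Q * bool)%type.
Definition step_src (e : step) : vert Q := if e.2 then src e.1 else tgt e.1.
Definition step_tgt (e : step) : vert Q := if e.2 then tgt e.1 else src e.1.
Definition step_inv (e : step) : step := (e.1, ~~ e.2).

Fixpoint is_walk (v : vert Q) (w : seq step) : bool :=
  if w is e :: w' then (step_src e == v) && is_walk (step_tgt e) w' else true.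

Definition walk_end (v : vert Q) (w : seq step) : vert Q :=
  last v (map step_tgt w).

Definition walk_inv (w : seq step) : seq step := rev (map step_inv w).

Definition loop_at (v : vert Q) (w : seq step) : bool :=
  is_walk v w && (walk_end v w == v).

Definition connected : Prop :=
  (0 < #|vert Q|)%N /\
  forall v w : vert Q, exists s, is_walk v s /\ walk_end v s = w.

(* Homotopy, with fixed endpoints, of walks starting at v: pi_1(Q, v) is the
   group of classes of loops at v. *)
Inductive homotopic (v : vert Q) : seq step -> seq step -> Prop :=
| HomotopicRefl w : homotopic v w w
| HomotopicSym w w' : homotopic v w w' -> homotopic v w' w
| HomotopicTrans w w' w'' :
    homotopic v w w' -> homotopic v w' w'' -> homotopic v w w''
| HomotopicBacktrack w w' e : is_walk v (w ++ e :: step_inv e :: w') ->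
    homotopic v (w ++ e :: step_inv e :: w') (w ++ w').

End Walks.

Record qmorphism (Q' Q : quiver) := QMorphism {
  fvert : vert Q' -> vert Q;
  farr : arr Q' -> arr Q;
  fsrc : forall a, src (farr a) = fvert (src a);
  ftgt : forall a, tgt (farr a) = fvert (tgt a)
}.

Section Coverings.
Variables (Q' Q : quiver) (F : qmorphism Q' Q).

Definition covering : Prop :=
  [/\ forall v, exists v', fvert F v' = v,
      forall v' a, src a = fvert F v' ->
        exists! a', src a' = v' /\ farr F a' = a &
      forall v' a, tgt a = fvert F v' ->
        exists! a', tgt a' = v' /\ farr F a' = a].

Definition map_walk (w : seq (step Q')) : seq (step Q) :=
  [seq (farr F e.1, e.2) | e <- w].

(* The image of pi_1(Q', v') is a normal subgroup of pi_1(Q, F(v')). *)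
Definition normal_image_pi1 (v' : vert Q') : Prop :=
  forall g h', loop_at (fvert F v') g -> loop_at v' h' ->
    exists k', loop_at v' k' /\
      homotopic (fvert F v') (g ++ map_walk h' ++ walk_inv g) (map_walk k').

(* Covering spaces are connected, so that regularity does not depend on v'. *)
Definition regular_covering : Prop :=
  [/\ covering, connected Q' & forall v', normal_image_pi1 v'].

(* The automorphism group of the covering F, as a set of pairs (permutation of
   the vertices, permutation of the arrows); it is finite as Q' is.  Conversely,
   a connected regular covering of a finite quiver with a finite automorphism
   group is finite, its fibres being in bijection with the group. *)
Definition deck_group : {set {perm vert Q'} * {perm arr Q'}} :=
  [set g : {perm vert Q'} * {perm arr Q'} | [forall v, fvert F (g.1 v) == fvert F v] &&
           [forall a, [&& farr F (g.2 a) == farr F a,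
              src (g.2 a) == g.1 (src a) & tgt (g.2 a) == g.1 (tgt a)]]].

Lemma map_composable v s :
  composable v s -> composable (fvert F v) (map (farr F) s).
Proof.
elim: s v => //= a s IH v /andP[/eqP <- /IH cs].
by rewrite fsrc eqxx /= ftgt.
Qed.

Definition map_path (p : qpath Q') : qpath Q :=
  @QPath Q (fvert F (psrc p), map (farr F) (parr p))
    (map_composable (qpath_ok p)).

Definition is_lifting (L : vert Q -> vert Q') : Prop :=
  forall v, fvert F (L v) = v.

(* [xget] returns the lifted path, which exists and is unique when F is a
   covering. *)
Definition lift_path (L : vert Q -> vert Q') (p : qpath Q) : qpath Q' :=
  xget (ptriv (L (psrc p)))
    [set p' | psrc p' = L (psrc p) /\ map_path p' = p]%classic.

Section Linear.
Variable K : fieldType.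

Definition map_pathalg (x : pathalg K Q') : pathalg K Q :=
  linext (fun p => pbasis K (map_path p)) x.

Definition lift_pathalg (L : vert Q -> vert Q') (x : pathalg K Q) :
    pathalg K Q' :=
  linext (fun p => pbasis K (lift_path L p)) x.

End Linear.
End Coverings.

Definition component (K : fieldType) (Q : quiver) (v w : vert Q)
    (x : pathalg K Q) : pathalg K Q :=
  linext (fun p => if (psrc p == v) && (ptgt p == w) then pbasis K p else 0) x.

Record relation_covering (K : fieldType) (Q' Q : quiver)
    (rho' : pathalg K Q' -> Prop) (rho : pathalg K Q -> Prop)
    (F : qmorphism Q' Q) : Prop := RelationCovering {
  rc_regular : regular_covering F;
  rc_lift : forall r', rho' r' <->
    exists L r, [/\ is_lifting F L, rho r & r' = lift_pathalg F L r];
  rc_component : forall r' v w, rho' r' ->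
    exists v' w', map_pathalg F (component v' w' r') =
                  component v w (map_pathalg F r')
}.

(* Main.v *)
From HB Require Import structures.
Require Import Defs.
From mathcomp Require Import all_boot all_order all_algebra perm.
From mathcomp Require Import finmap boolp classical_sets monalg.

Set Implicit Arguments.
Unset Strict Implicit.
Unset Printing Implicit Defensive.
Import GRing.Theory.
Local Open Scope ring_scope.
Local Notation pcomp := Defs.pcomp.
Local Notation map_path := Defs.map_path.

(** Write A = KQ/<rho> and A' = KQ'/<rho'>, with Jacobson radicals J and J'.
    Covering theory pulls an A-module M back to the A'-module whose component
    at a vertex v' is the component of M at F(v').  The pull-back is exact and
    preserves projectives, and it sends A/J to A'/J', so a projective
    resolution P of A/J pulls back to a projective resolution P' of A'/J'.
    It remains to compare the classes of Ext_A' computed with P' to those of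
    Ext_A computed with P.

    The pull-back is left adjoint to the restriction of scalars along the ring
    morphism A -> A' that maps a path to the sum of all its lifts; let eta be
    the unit of this adjunction.  Since A'/J' is the direct sum of simple
    modules, one for each vertex of Q', a map f from a pulled back module to
    A'/J' is the sum of its components f_i followed by the projections of A'/J'
    onto these simples, where f_i(m) is the coordinate at i of f(eta(m)).  Each
    f_i is A-linear with values in A/J, and it is a cocycle if f is one
    ([pull_comp_linear], [pull_decomp]).  Yoneda products are computed by
    chain lifts, and chain lifts pull back; so if a class over A is a sum of
    products of classes of degree 1, then so is its pull-back followed by any
    endomorphism of A'/J' ([pull_ext1_power]).  Therefore generation in degrees
    0 and 1 passes from A to A' ([pull_ext_generated]).

    Two ring-theoretic maps encode the covering: the transfer A -> A' above, and
    the map that sends x in A' to the matrix, indexed by the vertices of Q',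
    whose (i, j) entry is the image in A of the part of x supported on the
    paths from i to j.  Modules are pulled back along the latter.  The transfer
    kills rho because e_i times the transfer of r is e_i times a lift of r; the
    entries kill rho' because, by the condition on components, the entries of a
    lift of r are 0 or components of r ([entry_rel]).

    As rho and rho' are quadratic, J and J' consist of the elements without
    constant term at any vertex, once the paths of large length vanish
    ([in_jacobsonP]).  For A this follows from finite dimension and the length
    grading ([vanish_from_findim]); it passes to A' by unique path lifting
    ([vanish_lift]), which also makes A' finite-dimensional. *)

(** * Rings related by transfer and matrix maps, and pulled back modules *)

(** An axiomatization of what a covering gives on the level of rings: A' acts
    on families indexed by [tr_ix] through matrices over A, the [tr_idem i]
    being the images in A of the orthogonal idempotents [tr_unit i] of A'.  The
    last two laws relate [tr_map] to the matrices; they make the unit of the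
    adjunction between pull-back and restriction A-linear and the
    transposed maps A'-linear, respectively. *)
Record transfer (A A' : pzRingType) := Transfer {
  tr_ix : finType;
  tr_idem : tr_ix -> A;
  tr_unit : tr_ix -> A';
  tr_map : {rmorphism A -> A'};
  tr_ent : A' -> tr_ix -> tr_ix -> A;
  tr_entD : forall x y i j, tr_ent (x + y) i j = tr_ent x i j + tr_ent y i j;
  tr_entM : forall x y i j,
    tr_ent (x * y) i j = \sum_k tr_ent x i k * tr_ent y k j;
  tr_ent1 : forall i j, tr_ent 1 i j = if i == j then tr_idem i else 0;
  tr_ent_unit : forall i j k,
    tr_ent (tr_unit i) j k = if (j == i) && (k == i) then tr_idem i else 0;
  tr_row_sum : forall a i, \sum_j tr_ent (tr_map a) i j = tr_idem i * a;
  tr_col_sum : forall x j,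
    \sum_i tr_unit i * tr_map (tr_ent x i j) = x * tr_unit j
}.

Section PullUp.
Variables (A A' : pzRingType) (D : transfer A A').
Notation ix := (tr_ix D).
Notation ent := (@tr_ent _ _ D).
Notation idem := (@tr_idem _ _ D).

Lemma tr_idemK i : idem i * idem i = idem i.
Proof.
have := @tr_entM _ _ D 1 1 i i; rewrite mulr1 {1}tr_ent1 eqxx => e.
rewrite [RHS]e (bigD1 i) //= big1 ?addr0 => [|k ki]; first by rewrite tr_ent1 eqxx.
by rewrite tr_ent1 eq_sym (negPf ki) mul0r.
Qed.

Lemma tr_ent_l x i j : idem i * ent x i j = ent x i j.
Proof.
rewrite -{2}(mul1r x) tr_entM (bigD1 i) //= big1 ?addr0 => [|k ki].
  by rewrite tr_ent1 eqxx.
by rewrite tr_ent1 eq_sym (negPf ki) mul0r.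
Qed.

Lemma tr_ent_r x i j : ent x i j * idem j = ent x i j.
Proof.
rewrite -{2}(mulr1 x) tr_entM (bigD1 j) //= big1 ?addr0 => [|k kj].
  by rewrite tr_ent1 eqxx.
by rewrite tr_ent1 (negPf kj) mulr0.
Qed.

Lemma tr_unitK i : tr_unit i * tr_map D (idem i) = tr_unit i.
Proof.
have := @tr_col_sum _ _ D 1 i; rewrite mul1r => e.
rewrite -[RHS]e (bigD1 i) //= [X in _ + X]big1 ?addr0 ?tr_ent1 ?eqxx // => k ki.
by rewrite tr_ent1 (negPf ki) rmorph0 mulr0.
Qed.

Section Module.
Variable M : lmodType A.

(** The matrix of 1 is the diagonal matrix of the [tr_idem i], so A' acts
    unitally only on the families whose i-th component is fixed by
    [tr_idem i]. *)
Definition pull_pred : pred {ffun ix -> M} :=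
  fun x => [forall i, idem i *: x i == x i].

Fact pull_pred_zmod : zmod_closed pull_pred.
Proof.
split; first by apply/forallP => i; rewrite ffunE scaler0.
move=> x y /forallP px /forallP py; apply/forallP => i.
by rewrite !ffunE scalerBr (eqP (px i)) (eqP (py i)).
Qed.
HB.instance Definition _ :=
  GRing.isZmodClosed.Build {ffun ix -> M} pull_pred pull_pred_zmod.

Record pullup := PullUp { pull_val : {ffun ix -> M}; _ : pull_val \in pull_pred }.
HB.instance Definition _ := [isSub for pull_val].
HB.instance Definition _ := [Choice of pullup by <:].
HB.instance Definition _ := [SubChoice_isSubZmodule of pullup by <:].

Definition pull_fun (x : pullup) : ix -> M := pull_val x.
Coercion pull_fun : pullup >-> Funclass.

Lemma pull_idem (x : pullup) i : idem i *: x i = x i.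
Proof. by apply/eqP; have /forallP/(_ i) := valP x. Qed.

Lemma pullP (x y : pullup) : (forall i, x i = y i) -> x = y.
Proof. by move=> xy; apply/val_inj/ffunP => i; apply: xy. Qed.

Lemma pullD (x y : pullup) i : (x + y) i = x i + y i.
Proof. by rewrite /pull_fun -[pull_val (x + y)]/(val (x + y)) GRing.valD ffunE. Qed.
Lemma pull0 i : (0 : pullup) i = 0.
Proof. by rewrite /pull_fun -[pull_val 0]/(val (0 : pullup)) GRing.val0 ffunE. Qed.
Lemma pull_sum (I : Type) (r : seq I) (P : pred I) (x : I -> pullup) i :
  (\sum_(k <- r | P k) x k) i = \sum_(k <- r | P k) x k i.
Proof.
by apply: (big_morph (fun y : pullup => y i)) => [y z|]; rewrite ?pullD ?pull0.
Qed.

Definition pull_mk_fun (x : ix -> M) : {ffun ix -> M} :=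
  [ffun i => idem i *: x i].
Fact pull_mk_subproof x : pull_mk_fun x \in pull_pred.
Proof. by apply/forallP => i; rewrite !ffunE scalerA tr_idemK. Qed.
Definition pull_mk x : pullup := PullUp (pull_mk_subproof x).

Lemma pull_mkE x i : pull_mk x i = idem i *: x i.
Proof. by rewrite /pull_fun ffunE. Qed.

Definition pull_scale (a : A') (x : pullup) : pullup :=
  pull_mk (fun i => \sum_j ent a i j *: x j).

Lemma pull_scaleE a x i : pull_scale a x i = \sum_j ent a i j *: x j.
Proof.
rewrite pull_mkE scaler_sumr; apply: eq_bigr => j _.
by rewrite scalerA tr_ent_l.
Qed.

Fact pull_scaleA a b x : pull_scale a (pull_scale b x) = pull_scale (a * b) x.
Proof.
apply: pullP => i; rewrite !pull_scaleE.
under eq_bigr do rewrite pull_scaleE scaler_sumr.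
rewrite exchange_big /=; apply: eq_bigr => j _.
rewrite tr_entM scaler_suml; apply: eq_bigr => k _.
by rewrite scalerA.
Qed.
Fact pull_scale1 : left_id 1 pull_scale.
Proof.
move=> x; apply: pullP => i.
rewrite pull_scaleE (bigD1 i) //= big1 ?addr0 => [|k ki].
  by rewrite tr_ent1 eqxx pull_idem.
by rewrite tr_ent1 eq_sym (negPf ki) scale0r.
Qed.
Fact pull_scaleDr : right_distributive pull_scale +%R.
Proof.
move=> a x y; apply: pullP => i; rewrite pullD !pull_scaleE -big_split.
by apply: eq_bigr => j _; rewrite pullD scalerDr.
Qed.
Fact pull_scaleDl x : {morph pull_scale^~ x : a b / a + b}.
Proof.
move=> a b; apply: pullP => i; rewrite pullD !pull_scaleE -big_split.
by apply: eq_bigr => j _; rewrite tr_entD scalerDl.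
Qed.
HB.instance Definition _ := GRing.Zmodule_isLmodule.Build A' pullup
  pull_scaleA pull_scale1 pull_scaleDr pull_scaleDl.

Lemma pullZ (a : A') (x : pullup) i : (a *: x) i = \sum_j ent a i j *: x j.
Proof. exact: pull_scaleE. Qed.

Lemma pullZ_unit i (x : pullup) j :
  (tr_unit i *: x) j = if j == i then x i else 0.
Proof.
rewrite pullZ (bigD1 i) //= big1 ?addr0 => [|k ki]; last first.
  by rewrite tr_ent_unit (negPf ki) andbF scale0r.
by rewrite tr_ent_unit eqxx andbT; case: eqP => _; rewrite ?pull_idem ?scale0r.
Qed.

(** The unit of the adjunction between pull-back and restriction. *)
Definition pull_eta (m : M) : pullup := pull_mk (fun=> m).

Lemma pull_etaE m i : pull_eta m i = idem i *: m.
Proof. exact: pull_mkE. Qed.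

Lemma pull_etaZ a m : pull_eta (a *: m) = tr_map D a *: pull_eta m.
Proof.
apply: pullP => i; rewrite pull_etaE pullZ scalerA -tr_row_sum scaler_suml.
by apply: eq_bigr => j _; rewrite pull_etaE scalerA tr_ent_r.
Qed.

Lemma pull_etaD m n : pull_eta (m + n) = pull_eta m + pull_eta n.
Proof. by apply: pullP => i; rewrite pullD !pull_etaE scalerDr. Qed.

(** The image of [pull_eta] generates the pull-back, so that maps
    out of a pull-back are determined by their composites with [pull_eta]. *)
Lemma pull_sumE (x : pullup) : x = \sum_i tr_unit i *: pull_eta (x i).
Proof.
apply: pullP => j; rewrite pull_sum (bigD1 j) //= big1 ?addr0 => [|k kj].
  by rewrite pullZ_unit eqxx pull_etaE pull_idem.
by rewrite pullZ_unit eq_sym (negPf kj).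
Qed.

End Module.

Section Map.
Variables (M N : lmodType A) (f : {linear M -> N}).

Definition pull_map (x : pullup M) : pullup N := pull_mk (fun i => f (x i)).

Lemma pull_mapE x i : pull_map x i = f (x i).
Proof. by rewrite pull_mkE -linearZ pull_idem. Qed.

Fact pull_map_linear : linear pull_map.
Proof.
move=> a x y; apply: pullP => i; rewrite pullD pullZ !pull_mapE pullD pullZ.
rewrite linearD linear_sum; congr (_ + _); apply: eq_bigr => j _.
by rewrite linearZ pull_mapE.
Qed.
HB.instance Definition _ := GRing.isLinear.Build A' (pullup M) (pullup N) _
  pull_map pull_map_linear.

Lemma pull_map_eta m : pull_map (pull_eta m) = pull_eta (f m).
Proof. by apply: pullP => i; rewrite pull_mapE !pull_etaE linearZ. Qed.

End Map.
End PullUp.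

(** The type mentions [h] so that [h] can select the module structure put on
    the carrier of [N]. *)
Definition restrict_mod (A A' : pzRingType) (h : {rmorphism A -> A'})
  (N : lmodType A') : Type := N.

Section Restriction.
Variables (A A' : pzRingType) (h : {rmorphism A -> A'}) (N : lmodType A').
Notation restrict := (restrict_mod h N).

HB.instance Definition _ := GRing.Zmodule.copy restrict N.

Definition restrict_scale (a : A) (x : restrict) : restrict := h a *: (x : N).
Fact restrict_scaleA a b x :
  restrict_scale a (restrict_scale b x) = restrict_scale (a * b) x.
Proof. by rewrite /restrict_scale scalerA rmorphM. Qed.
Fact restrict_scale1 : left_id 1 restrict_scale.
Proof. by move=> x; rewrite /restrict_scale rmorph1 scale1r. Qed.
Fact restrict_scaleDr : right_distributive restrict_scale +%R.
Proof. by move=> a x y; apply: scalerDr. Qed.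
Fact restrict_scaleDl x : {morph restrict_scale^~ x : a b / a + b}.
Proof. by move=> a b; rewrite /restrict_scale rmorphD scalerDl. Qed.
HB.instance Definition _ := GRing.Zmodule_isLmodule.Build A restrict
  restrict_scaleA restrict_scale1 restrict_scaleDr restrict_scaleDl.

Lemma restrictZ a (x : restrict) : a *: x = h a *: (x : N).
Proof. by []. Qed.

End Restriction.

Section Adjunction.
Variables (A A' : pzRingType) (D : transfer A A') (M : lmodType A).
Notation restr := (restrict_mod (tr_map D)).

Section Down.
Variables (N : lmodType A') (f : {linear pullup D M -> N}).

Definition adj_down (m : M) : restr N := f (pull_eta D m).

Fact adj_down_linear : linear adj_down.
Proof.
by move=> a x y; rewrite /adj_down pull_etaD pull_etaZ linearP restrictZ.
Qed.
HB.instance Definition _ := GRing.isLinear.Build A M (restr N) _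
  adj_down adj_down_linear.

Lemma adj_downK x : f x = \sum_i tr_unit i *: (adj_down (x i) : N).
Proof.
by rewrite {1}[x]pull_sumE linear_sum; apply: eq_bigr => i _; rewrite linearZ.
Qed.

End Down.

Section Up.
Variables (N : lmodType A') (f : {linear M -> restr N}).

Definition adj_up (x : pullup D M) : N := \sum_i tr_unit i *: (f (x i) : N).

Fact adj_up_linear : linear adj_up.
Proof.
move=> a x y; rewrite /adj_up.
under eq_bigr do rewrite pullD pullZ linearD scalerDr.
rewrite big_split /=; congr (_ + _).
under eq_bigr do rewrite linear_sum scaler_sumr.
rewrite exchange_big /= scaler_sumr; apply: eq_bigr => j _.
rewrite scalerA -tr_col_sum scaler_suml; apply: eq_bigr => i _.
by rewrite linearZ -scalerA.
Qed.
HB.instance Definition _ := GRing.isLinear.Build A' (pullup D M) N _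
  adj_up adj_up_linear.

End Up.

Fact restrict_map_linear (N N' : lmodType A') (g : {linear N -> N'}) :
  linear (g : restr N -> restr N').
Proof. by move=> a x y; rewrite linearP. Qed.

(** A left adjoint of an exact functor preserves projectives: transpose
    the map, lift the transpose over A, and transpose back. *)
Lemma pullup_projective : projective M -> projective (pullup D M).
Proof.
move=> projM N1 N2 g f gsurj.
pose g' : {linear restr N1 -> restr N2} :=
  HB.pack (g : restr N1 -> restr N2)
    (GRing.isLinear.Build A (restr N1) (restr N2) _ _ (restrict_map_linear g)).
have [h hP] := projM _ _ g' (adj_down f) gsurj.
exists (adj_up h) => x; rewrite [RHS]adj_downK /= /adj_up linear_sum; apply: eq_bigr => i _.
by rewrite linearZ -[in RHS]hP.
Qed.

End Adjunction.

(** * Pulling back resolutions and Ext classes *)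

Section PullExact.
Variables (A A' : pzRingType) (D : transfer A A').

Lemma pull_map_image (M N : lmodType A) (f : {linear M -> N}) (y : pullup D N) :
  (forall i, exists x, f x = y i) -> exists x, pull_map f x = y.
Proof.
move=> /choice[x fx]; exists (pull_mk x); apply: pullP => i.
by rewrite pull_mapE pull_mkE linearZ_LR fx pull_idem.
Qed.

(** The pull-back is computed componentwise, hence exact. *)
Lemma pull_map_exact (M N R : lmodType A) (f : {linear M -> N})
    (g : {linear N -> R}) :
  (forall x, g x = 0 <-> exists y, f y = x) ->
  forall x : pullup D N, pull_map g x = 0 <-> exists y, pull_map f y = x.
Proof.
move=> fg x; split=> [gx0|[y <-]].
  by apply: pull_map_image => i; apply/fg; rewrite -pull_mapE gx0 pull0.
apply: pullP => i; rewrite pull0 pull_mapE; apply/fg.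
by exists (y i); rewrite pull_mapE.
Qed.

End PullExact.

Section PullResolution.
Variables (A A' : pzRingType) (D : transfer A A').
Variables (S : lmodType A) (S' : lmodType A') (P : proj_resolution S).
Variables (iso : {linear pullup D S -> S'}) (iso_inv : {linear S' -> pullup D S}).
Hypotheses (isoK : cancel iso iso_inv) (iso_invK : cancel iso_inv iso).

Fact pull_aug_surj y : exists x, (iso \o pull_map (res_aug P)) x = y.
Proof.
have [i|x Px] := @pull_map_image _ _ D _ _ (res_aug P) (iso_inv y).
  exact: res_aug_surj.
by exists x; rewrite /= Px iso_invK.
Qed.

Fact pull_aug_exact x :
  (iso \o pull_map (res_aug P)) x = 0 <->
  exists y, pull_map (D := D) (res_d P 0) y = x.
Proof.
rewrite -(pull_map_exact (@res_exact0 _ _ P)) /=; split=> [|->].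
  by move/(congr1 iso_inv); rewrite isoK linear0.
by rewrite linear0.
Qed.

Definition pull_resolution : proj_resolution S' :=
  @ProjResolution A' S' (fun n => pullup D (P n))
    (fun n => pull_map (res_d P n)) (iso \o pull_map (res_aug P))
    (fun n => pullup_projective (@res_projective _ _ P n))
    pull_aug_surj pull_aug_exact
    (fun n => pull_map_exact (@res_exact _ _ P n)).
Notation P' := pull_resolution.

Lemma pull_cocycle n (f : {linear P n -> S}) (e : {linear pullup D S -> S'}) :
  cocycle f -> @cocycle _ _ P' n (e \o pull_map f).
Proof.
move=> cf x /=; rewrite (_ : pull_map f _ = 0) ?linear0 //.
by apply: pullP => i; rewrite pull0 !pull_mapE cf.
Qed.

Lemma ext1_power_ext (R : pzRingType) (M : lmodType R) (L : proj_resolution M)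
    n (f g : {linear L n -> M}) : f =1 g -> ext1_power f -> ext1_power g.
Proof.
move=> fg pf; apply: (Ext1PowerCoh pf); case: n f g fg {pf} => [|n] f g fg /=.
  by move=> x; rewrite fg.
by exists \0 => x; rewrite addr0 fg.
Qed.

(** The composite with [e] is carried through the induction because
    the product case needs two of them: [e] itself for the factor of degree 1,
    and [iso] for the other factor, whose chain lift is the pull-back of the
    given one. *)
Lemma pull_ext1_power n (f : {linear P n -> S}) :
  ext1_power f -> forall e : {linear pullup D S -> S'},
  @ext1_power _ _ P' n (e \o pull_map f).
Proof.
elim: n f / => [f cf|n g f F h cg pf IHf [F0 FS] hE|n f g h _ IHf _ IHg hE
  |n f g _ IHf gf] e.
- by apply: Ext1PowerGen; apply: pull_cocycle.
- apply: (@Ext1PowerMul _ _ P' n (e \o pull_map g) (iso \o pull_map f)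
           (fun k => pull_map (F k))).
  + exact: pull_cocycle.
  + exact: IHf.
  + split=> [x|k x] /=.
      by congr (iso _); apply: pullP => i; rewrite !pull_mapE F0.
    by apply: pullP => i; rewrite !pull_mapE FS.
  + by move=> x /=; congr (e _); apply: pullP => i; rewrite !pull_mapE hE.
- apply: (Ext1PowerAdd (IHf e) (IHg e)) => x /=; rewrite -linearD.
  by congr (e _); apply: pullP => i; rewrite pullD !pull_mapE hE.
- apply: (Ext1PowerCoh (IHf e)); case: n f g {IHf} gf => [|n] f g /= gf.
    by move=> x; congr (e _); apply: pullP => i; rewrite !pull_mapE gf.
  case: gf => h gf; exists (e \o pull_map h) => x /=; rewrite -linearD.
  by congr (e _); apply: pullP => i; rewrite pullD !pull_mapE gf.
Qed.

Lemma ext1_power_sum (R : pzRingType) (M : lmodType R) (L : proj_resolution M)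
    n (T : Type) (r : seq T) (f : {linear L n -> M}) (g : T -> {linear L n -> M}) :
  @ext1_power _ _ L n \0 -> (forall i, ext1_power (g i)) ->
  (forall x, f x = \sum_(i <- r) g i x) -> ext1_power f.
Proof.
move=> p0 pg; elim: r f => [|i r IH] f fE.
  by apply: ext1_power_ext p0 => x; rewrite fE big_nil.
pose s x := \sum_(i <- r) g i x.
have ls : linear s.
  move=> a x y; rewrite /s scaler_sumr -big_split; apply: eq_bigr => j _.
  by rewrite linearP.
pose s' : {linear L n -> M} := HB.pack s (GRing.isLinear.Build R (L n) M _ s ls).
have ps : ext1_power s' by apply: IH.
by apply: (Ext1PowerAdd (pg i) ps) => x; rewrite fE big_cons.
Qed.

(* Over a semisimple [S] on which positive paths act by zero, the matrices act
   diagonally, and the idempotents commute with the action of A. *)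
Hypothesis offdiag : forall (a : A') i j (s : S), i != j -> @tr_ent _ _ D a i j *: s = 0.
Hypothesis diag : forall (i : tr_ix D) a (s : S), tr_idem i *: (a *: s) = a *: (tr_idem i *: s).

(** The projection onto a vertex component; its A'-linearity is where
    the off-diagonal entries have to act by zero. *)
Definition pull_proj (i : tr_ix D) (s : pullup D S) : pullup D S :=
  pull_mk (fun j => if j == i then s i else 0).

Lemma pull_projE i s j : pull_proj i s j = if j == i then s i else 0.
Proof.
by rewrite pull_mkE; case: eqP => [->|_]; rewrite ?pull_idem ?scaler0.
Qed.

Fact pull_proj_linear i : linear (pull_proj i).
Proof.
move=> a s t; apply: pullP => j; rewrite pullD pullZ !pull_projE.
rewrite pullD pullZ (bigD1 i) //= [in RHS](bigD1 i) //= !pull_projE eqxx.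
rewrite !big1 => [|k ki|k ki]; rewrite ?addr0; last 2 first.
- by rewrite pull_projE (negPf ki) scaler0.
- by rewrite offdiag // eq_sym.
by case: (eqVneq j i) => [->//|ji]; rewrite offdiag ?addr0.
Qed.
HB.instance Definition _ i := GRing.isLinear.Build A' (pullup D S) (pullup D S) _
  (pull_proj i) (pull_proj_linear i).

(** Through the transfer, A acts on the pull-back of [S] componentwise;
    this makes the components [pull_comp] linear. *)
Lemma pullZ_map a i (s : pullup D S) : (tr_map D a *: s) i = a *: s i.
Proof.
rewrite pullZ (bigD1 i) //= big1 ?addr0 => [|k ki]; last first.
  by rewrite offdiag // eq_sym.
rewrite -{2}(pull_idem s i) -diag scalerA -tr_row_sum scaler_suml.
by rewrite [RHS](bigD1 i) //= big1 ?addr0 // => k ki; rewrite offdiag // eq_sym.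
Qed.

Section Component.
Variables (M : lmodType A) (f : {linear pullup D M -> S'}) (i : tr_ix D).

(** The component at [i] of the transpose of [f]. *)
Definition pull_comp (m : M) : S := iso_inv (f (pull_eta D m)) i.

Fact pull_comp_linear : linear pull_comp.
Proof.
move=> a x y; rewrite /pull_comp pull_etaD pull_etaZ !linearP pullD.
by rewrite pullZ_map.
Qed.
HB.instance Definition _ := GRing.isLinear.Build A M S _
  pull_comp pull_comp_linear.

(** Multiplication by the unit at [i] does not change the i-th
    coordinate, and it sends [x] and [pull_eta (x i)] to the same element. *)
Lemma pull_compE (x : pullup D M) : pull_comp (x i) = iso_inv (f x) i.
Proof.
have e (s : pullup D S) : s i = (tr_unit i *: s) i.
  by rewrite pullZ_unit eqxx.
rewrite /pull_comp [LHS]e [RHS]e -!linearZ /=; congr (iso_inv (f _) i).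
apply: pullP => j; rewrite !pullZ_unit; case: eqP => // _.
by rewrite pull_etaE pull_idem.
Qed.

End Component.

Lemma pull_decomp (M : lmodType A) (f : {linear pullup D M -> S'})
    (x : pullup D M) :
  f x = \sum_i iso (pull_proj i (pull_map (pull_comp f i) x)).
Proof.
rewrite -linear_sum -[LHS]iso_invK; congr (iso _); apply: pullP => j.
rewrite pull_sum (bigD1 j) //= big1 ?addr0 => [|i ij]; rewrite pull_projE.
  by rewrite eqxx pull_mapE /= pull_compE.
by rewrite eq_sym (negPf ij).
Qed.

Lemma pull_ext_generated :
  (forall n (f : {linear P n -> S}), (2 <= n)%N -> cocycle f -> ext1_power f) ->
  forall n (f : {linear P' n -> S'}), (2 <= n)%N -> cocycle f -> ext1_power f.
Proof.
move=> genP n f n2 cf.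
apply: (@ext1_power_sum _ _ P' n (tr_ix D) (index_enum (tr_ix D)) f
  (fun i => iso \o (pull_proj i \o pull_map (pull_comp f i)))).
- apply: (@ext1_power_ext _ _ P' n (\0 \o pull_map \0)) => //.
  apply: pull_ext1_power; apply: genP => // x.
- move=> i.
  apply: (@ext1_power_ext _ _ P' n
    ((iso \o pull_proj i) \o pull_map (pull_comp f i))) => //.
  apply: pull_ext1_power; apply: genP => // x.
  by rewrite /= /pull_comp -pull_map_eta [f _]cf linear0 pull0.
- exact: pull_decomp.
Qed.

End PullResolution.

(** * Path algebras: lengths of paths and evaluation at the vertices *)

Section QuotientLift.
Variables (A : pzRingType) (I : ideal2 A) (V : zmodType).

Definition quot_lift (f : A -> V) (q : quotring I) : V :=
  f (projT1 (cid (quotring_pi_surj q))).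

Lemma quot_liftE (f : A -> V) : zmod_morphism f -> (forall x, I x -> f x = 0) ->
  forall x, quot_lift f (quotring_pi I x) = f x.
Proof.
move=> fB fI x; rewrite /quot_lift; case: cid => y /= /quotring_pi_eq Iyx.
by apply/eqP; rewrite -subr_eq0 -fB fI.
Qed.

Lemma quotring_pi0 x : quotring_pi I x = 0 <-> I x.
Proof. by rewrite -(rmorph0 (quotring_pi I)) quotring_pi_eq subr0. Qed.

End QuotientLift.


(** Sealed, as are the other linear maps on path algebras below: conversion
    between two of their values must not unfold finitely supported functions. *)
HB.lock Definition trunc (K : fieldType) (Q : quiver) (P : pred nat)
  (x : pathalg K Q) : pathalg K Q :=
  linext (fun p => if P (plen p) then pbasis K p else 0) x.

(** The character of the path algebra attached to the simple module at [v]. *)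
HB.lock Definition aug (K : fieldType) (Q : quiver) (v : vert Q)
  (x : pathalg K Q) : K := (x : {malg K[qpath Q]})@_(ptriv v).

Section Truncation.
Variables (K : fieldType) (Q : quiver).
Notation KQ := (pathalg K Q).
Notation pb := (pbasis K).
Implicit Types (p q : qpath Q) (x y : KQ).

Lemma coef_pbasis p q : (pb p : {malg K[qpath Q]})@_q = (p == q)%:R.
Proof. by rewrite mcoeffU. Qed.

Lemma pathalg_sumE x : x = \sum_(p <- msupp x) x@_p *: pb p.
Proof. exact: malg_linE. Qed.

(** Contains [homogeneous n] (lengths equal to n) and the length
    filtration (lengths at least n) as instances. *)
Definition lengths (P : nat -> Prop) x := forall p, p \in msupp x -> P (plen p).

Lemma lengthsP (P : nat -> Prop) x :
  lengths P x <-> forall p, ~ P (plen p) -> (x : {malg K[qpath Q]})@_p = 0.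
Proof.
split=> Px p; first by move=> nP; apply: mcoeff_outdom; apply/negP => /Px.
rewrite -mcoeff_neq0 => xp; apply: contrapT => /Px x0.
by rewrite x0 eqxx in xp.
Qed.

Lemma homogeneousE n x : homogeneous n x = lengths (fun l => l = n) x.
Proof. by []. Qed.

Section Lengths.
Variable P : nat -> Prop.

Lemma lengths0 : lengths P (0 : KQ).
Proof. by apply/lengthsP => p _; exact: mcoeff0. Qed.
Lemma lengthsD x y : lengths P x -> lengths P y -> lengths P (x + y).
Proof.
move=> /lengthsP Px /lengthsP Py; apply/lengthsP => p np.
by rewrite [LHS]mcoeffD Px // Py // addr0.
Qed.
Lemma lengthsZ a x : lengths P x -> lengths P (a *: x).
Proof.
move=> /lengthsP Px; apply/lengthsP => p np.
by rewrite [LHS]mcoeffZ Px // mulr0.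
Qed.
Lemma lengths_pbasis p : P (plen p) -> lengths P (pb p).
Proof. by move=> Pp q; rewrite msuppU oner_eq0 inE => /eqP->. Qed.
Lemma lengths_sum (I : Type) (r : seq I) (f : I -> KQ) :
  (forall i, lengths P (f i)) -> lengths P (\sum_(i <- r) f i).
Proof.
move=> Pf; elim: r => [|i r IH]; first by rewrite big_nil; exact: lengths0.
by rewrite big_cons; apply: lengthsD.
Qed.
Lemma lengths_sum_seq (T : eqType) (r : seq T) (f : T -> KQ) :
  (forall i, i \in r -> lengths P (f i)) -> lengths P (\sum_(i <- r) f i).
Proof.
move=> Pf; rewrite big_seq; elim/big_rec: _ => [|i x ri Px]; first exact: lengths0.
by apply: lengthsD => //; apply: Pf.
Qed.
End Lengths.

Lemma pathalg_mul_pbasis p q : pb p * pb q = obasis K (pcomp p q).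
Proof. exact: pmulU. Qed.

Lemma plen_pcomp p q r : pcomp p q = Some r -> plen r = (plen p + plen q)%N.
Proof. by case: pcompP => // s _ _ e _ [<-]; rewrite /plen e size_cat. Qed.

Lemma pathalg_scaleAl a x y : a *: x * y = a *: (x * y).
Proof. exact: pmulZl. Qed.
Lemma pathalg_scaleAr a x y : x * (a *: y) = a *: (x * y).
Proof. exact: pmulZr. Qed.

Lemma lengthsM (P1 P2 P3 : nat -> Prop) x y :
  (forall m n, P1 m -> P2 n -> P3 (m + n)%N) ->
  lengths P1 x -> lengths P2 y -> lengths P3 (x * y).
Proof.
move=> PM Px Py; rewrite [x]pathalg_sumE [y]pathalg_sumE mulr_suml.
apply: lengths_sum_seq => p xp; rewrite mulr_sumr.
apply: lengths_sum_seq => q yq.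
rewrite pathalg_scaleAl pathalg_scaleAr; do 2!apply: lengthsZ.
rewrite pathalg_mul_pbasis; case epq: pcomp => [r|]; last exact: lengths0.
by apply: lengths_pbasis; rewrite (plen_pcomp epq); apply: PM; [apply: Px | apply: Py].
Qed.

Fact trunc_linear P : linear (@trunc K Q P).
Proof. by move=> a x y; rewrite unlock; exact: linext_linear. Qed.
HB.instance Definition _ P := GRing.isLinear.Build K KQ KQ _ (@trunc K Q P)
  (trunc_linear P).

Lemma trunc_pbasis P p : trunc P (pb p) = if P (plen p) then pb p else 0.
Proof. by rewrite unlock; exact: linextU. Qed.

Lemma linext_filter_coef (c : pred (qpath Q)) x p :
  (linext (fun q => if c q then pb q else 0) x : {malg K[qpath Q]})@_p =
  if c p then (x : {malg K[qpath Q]})@_p else 0.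
Proof.
pose co (z : KQ) : K^o := (z : {malg K[qpath Q]})@_p.
have lc : linear co by move=> a y z; rewrite /co [LHS]mcoeffD mcoeffZ.
apply: (pathalg_ext
  (f := fun x => co (linext (fun q => if c q then pb q else 0) x))
  (g := fun x => if c p then co x else 0)).
- by move=> a y z; rewrite linearP lc.
- by move=> a y z; rewrite lc; case: (c p) => //; rewrite scaler0 addr0.
move=> q; rewrite linextU /co.
case: eqVneq (coef_pbasis q p) => [->|qp] e.
  by case: (c p) => //; exact: mcoeff0.
by rewrite e; case: (c q); rewrite ?e ?[LHS]mcoeff0 if_same.
Qed.

Lemma trunc_coef P x p :
  (trunc P x : {malg K[qpath Q]})@_p =
  if P (plen p) then (x : {malg K[qpath Q]})@_p else 0.
Proof. by rewrite unlock (linext_filter_coef (fun q => P (plen q))). Qed.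

Lemma trunc_lengths (P : pred nat) x : lengths P x -> trunc P x = x.
Proof.
move=> /lengthsP Px; apply/malgP => p; rewrite trunc_coef.
by case: ifPn => // /negP /Px ->.
Qed.

Lemma trunc_lengths0 (P : pred nat) x :
  lengths (fun n => ~~ P n) x -> trunc P x = 0.
Proof.
move=> /lengthsP Px; apply/malgP => p; rewrite trunc_coef mcoeff0.
by case: ifPn => // Pp; rewrite Px // Pp.
Qed.

Lemma lengths_trunc (P : pred nat) x : lengths P (trunc P x).
Proof. by apply/lengthsP => p /negP/negPf Pp; rewrite trunc_coef Pp. Qed.

Lemma homogeneous_trunc n x : homogeneous n (trunc (pred1 n) x).
Proof. by move=> p /lengths_trunc /eqP. Qed.

Lemma trunc_homogeneous n m x : homogeneous n x ->
  trunc (pred1 m) x = if m == n then x else 0.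
Proof.
move=> hx; case: eqP => [->|/eqP mn].
  by apply: trunc_lengths => p /hx /= ->.
by apply: trunc_lengths0 => p /hx /= ->; rewrite eq_sym.
Qed.

Lemma trunc_sum N x : lengths (fun n => n < N)%N x ->
  x = \sum_(n < N) trunc (pred1 (n : nat)) x.
Proof.
move=> /lengthsP lx; apply/malgP => p; rewrite (raddf_sum (mcoeff p)) /=.
have [pN|Np] := ltnP (plen p) N.
  rewrite (bigD1 (Ordinal pN)) //= big1 ?addr0 => [|i ip]; rewrite trunc_coef /=.
    by rewrite eqxx.
  by case: eqP => // pi; case/eqP: ip; apply/val_inj.
rewrite lx ?big1 // => [i _|]; last by apply/negP; rewrite -leqNgt.
rewrite trunc_coef /=; case: eqP => // pi.
by move: Np; rewrite pi leqNgt ltn_ord.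
Qed.

Lemma lengths_bound x : exists N, lengths (fun n => n < N)%N x.
Proof.
exists (\max_(p <- msupp x) plen p).+1 => p xp.
by rewrite ltnS; apply: leq_bigmax_seq.
Qed.

Lemma truncMl n p x : trunc (pred1 n) (pb p * x) =
  if (plen p <= n)%N then pb p * trunc (pred1 (n - plen p)%N) x else 0.
Proof.
move: x; apply: pathalg_ext => [a x y|a x y|q].
- by rewrite mulrDr pathalg_scaleAr linearP.
- rewrite linearP mulrDr pathalg_scaleAr.
  by case: ifP => // _; rewrite scaler0 addr0.
rewrite trunc_pbasis pathalg_mul_pbasis /=; case epq: pcomp => [r|] /=; last first.
  by rewrite linear0; case: ifP => //; case: eqP; rewrite ?mulr0 // pathalg_mul_pbasis epq.
rewrite trunc_pbasis (plen_pcomp epq) /=; case: leqP => pn.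
  have <- : (plen p + plen q == n)%N = (plen q == n - plen p)%N.
    by rewrite -{1}(subnKC pn) eqn_add2l.
  by case: eqP; rewrite ?mulr0 // pathalg_mul_pbasis epq.
by case: eqP => // e; move: pn; rewrite -e ltnNge leq_addr.
Qed.

Lemma truncMr n p x : trunc (pred1 n) (x * pb p) =
  if (plen p <= n)%N then trunc (pred1 (n - plen p)%N) x * pb p else 0.
Proof.
move: x; apply: pathalg_ext => [a x y|a x y|q].
- by rewrite mulrDl pathalg_scaleAl linearP.
- rewrite linearP mulrDl pathalg_scaleAl.
  by case: ifP => // _; rewrite scaler0 addr0.
rewrite trunc_pbasis pathalg_mul_pbasis /=; case eqp: pcomp => [r|] /=; last first.
  by rewrite linear0; case: ifP => //; case: eqP; rewrite ?mul0r // pathalg_mul_pbasis eqp.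
rewrite trunc_pbasis (plen_pcomp eqp) /= addnC; case: leqP => pn.
  have <- : (plen p + plen q == n)%N = (plen q == n - plen p)%N.
    by rewrite -{1}(subnKC pn) eqn_add2l.
  by case: eqP; rewrite ?mul0r // pathalg_mul_pbasis eqp.
by case: eqP => // e; move: pn; rewrite -e ltnNge leq_addr.
Qed.

Lemma aug_coef v x : aug v x = (x : {malg K[qpath Q]})@_(ptriv v).
Proof. by rewrite unlock. Qed.
Lemma aug0 (v : vert Q) : aug v (0 : KQ) = 0.
Proof. by rewrite aug_coef; exact: mcoeff0. Qed.
Lemma augD v x y : aug v (x + y) = aug v x + aug v y.
Proof. by rewrite !aug_coef; exact: mcoeffD. Qed.
Lemma augZ v a x : aug v (a *: x) = a * aug v x.
Proof. by rewrite !aug_coef; exact: mcoeffZ. Qed.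
Lemma aug_pbasis v p : aug v (pb p) = (p == ptriv v)%:R.
Proof. by rewrite aug_coef; exact: coef_pbasis. Qed.
Lemma aug_sum v (I : Type) (r : seq I) (f : I -> KQ) :
  aug v (\sum_(i <- r) f i) = \sum_(i <- r) aug v (f i).
Proof. by apply: (big_morph (aug v)); [apply: augD | exact: aug0]. Qed.

Lemma ptriv_inj : injective (@ptriv Q).
Proof. by move=> v w [->]. Qed.

Lemma plen0 p : plen p = 0%N -> p = ptriv (psrc p).
Proof. by move=> /size0nil e; apply: qpathP. Qed.

Lemma aug1 (v : vert Q) : aug v (1 : KQ) = 1.
Proof.
rewrite [1]/(pone K Q) /pone aug_sum (bigD1 v) //= big1 => [|w wv].
  by rewrite aug_pbasis eqxx addr0.
by rewrite aug_pbasis (inj_eq ptriv_inj) (negPf wv).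
Qed.

(** A composite of paths is trivial only if both factors are. *)
Lemma augM v x y : aug v (x * y) = aug v x * aug v y.
Proof.
move: x; apply: (pathalg_ext (V := K^o) (f := fun x => aug v (x * y))
  (g := fun x => aug v x * aug v y)) => [a x x'|a x x'|p].
- by rewrite mulrDl pathalg_scaleAl augD augZ.
- by rewrite augD augZ mulrDl -mulrA.
move: y; apply: (pathalg_ext (V := K^o) (f := fun y => aug v (pb p * y))
  (g := fun y => aug v (pb p) * aug v y)) => [a y y'|a y y'|q].
- by rewrite mulrDr pathalg_scaleAr augD augZ.
- by rewrite augD augZ mulrDr mulrCA.
rewrite pathalg_mul_pbasis !aug_pbasis; case epq: pcomp => [r|] /=.
  rewrite aug_pbasis -natrM mulnb; congr ((nat_of_bool _)%:R); apply/idP/idP.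
    move=> /eqP rv; move: (plen_pcomp epq); rewrite rv [LHS]/plen /=.
    move/esym/eqP; rewrite addn_eq0 => /andP[/eqP/plen0 ep /eqP/plen0 eq].
    move: (psrc p) (psrc q) ep eq => w w' ep eq.
    move: epq; rewrite ep eq pcomp_trivl rv /=; case: eqP => // -> [->].
    by rewrite eqxx.
  case/andP=> /eqP ep /eqP eq; move: epq; rewrite ep eq pcomp_trivl eqxx.
  by case=> <-.
rewrite aug0 -natrM mulnb; case: eqP => // ep; case: eqP => // eq.
by move: epq; rewrite ep eq pcomp_trivl eqxx.
Qed.

Lemma aug_scal (v : vert Q) (a : K) : aug v (pscal Q a) = a.
Proof. by rewrite augZ aug1 mulr1. Qed.

Lemma lengths_aug0 x : (forall v, aug v x = 0) -> lengths (fun n => 0 < n)%N x.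
Proof.
move=> ax; apply/lengthsP => p /negP; rewrite -eqn0Ngt => /eqP/plen0 ->.
by rewrite -aug_coef.
Qed.

End Truncation.

(** * Algebras with quadratic relations and their Jacobson radical *)

HB.lock Definition qpi (K : fieldType) (Q : quiver) (rho : pathalg K Q -> Prop)
  (x : pathalg K Q) : quiver_alg rho := quotring_pi (gen_ideal rho) x.

Section QuiverAlgebra.
Variables (K : fieldType) (Q : quiver) (rho : pathalg K Q -> Prop).
Notation KQ := (pathalg K Q).
Notation pb := (pbasis K).
Notation A := (quiver_alg rho).
Implicit Types (p q : qpath Q) (x y : KQ) (a b : A).

Notation qpi := (qpi rho).

Lemma qpiE x : qpi x = quotring_pi (gen_ideal rho) x.
Proof. by rewrite unlock. Qed.

Fact qpi_zmod : zmod_morphism qpi.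
Proof. by move=> x y; rewrite !qpiE; exact: rmorphB. Qed.
HB.instance Definition _ := GRing.isZmodMorphism.Build KQ A qpi qpi_zmod.
Fact qpi_monoid : monoid_morphism qpi.
Proof.
split=> [|x y]; rewrite !qpiE; first exact: rmorph1.
exact: rmorphM.
Qed.
HB.instance Definition _ := GRing.isMonoidMorphism.Build KQ A qpi qpi_monoid.

Lemma qpi0 : qpi 0 = 0. Proof. exact: rmorph0. Qed.
Lemma qpi1 : qpi 1 = 1. Proof. exact: rmorph1. Qed.
Lemma qpiD x y : qpi (x + y) = qpi x + qpi y. Proof. exact: rmorphD. Qed.
Lemma qpiB x y : qpi (x - y) = qpi x - qpi y. Proof. exact: rmorphB. Qed.
Lemma qpiM x y : qpi (x * y) = qpi x * qpi y. Proof. exact: rmorphM. Qed.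
Lemma qpi_sum (I : Type) (r : seq I) (P : pred I) (f : I -> KQ) :
  qpi (\sum_(i <- r | P i) f i) = \sum_(i <- r | P i) qpi (f i).
Proof. exact: rmorph_sum. Qed.

Lemma qpi0P x : qpi x = 0 <-> gen_ideal rho x.
Proof. by rewrite qpiE; exact: quotring_pi0. Qed.

Lemma qpi_surj a : exists x, qpi x = a.
Proof.
by have [x <-] := quotring_pi_surj (I := gen_ideal rho) a; exists x; exact: qpiE.
Qed.

Lemma qpi_scal c : kscal A c = qpi (pscal Q c).
Proof. by rewrite qpiE. Qed.

Lemma qpiZ c x : qpi (c *: x) = kscal A c * qpi x.
Proof. by rewrite qpi_scal -qpiM pscalE. Qed.

(** To show that a property holds on the ideal generated by [rho], check
    that it defines an ideal and holds on [rho]. *)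
Lemma gen_ideal_ind (I : ideal2 KQ) :
  (forall r, rho r -> I r) -> forall x, qpi x = 0 -> I x.
Proof. by move=> rI x /qpi0P; apply. Qed.

Lemma gen_ideal_sub r : rho r -> qpi r = 0.
Proof. by move=> rr; apply/qpi0P => I; apply. Qed.

(** The length grading in terms of the sealed projection [qpi]. *)
Lemma length_gradingP n a :
  length_grading n a <-> exists2 x, homogeneous n x & qpi x = a.
Proof.
by split=> -[x hx e]; exists x => //; move: e; rewrite qpiE.
Qed.

Lemma kscal_inj0 c a : c != 0 -> kscal A c * a = 0 -> a = 0.
Proof.
have [x <-] := qpi_surj a => c0; rewrite -qpiZ => cx0.
by rewrite -[x]scale1r -(mulVf c0) -scalerA qpiZ cx0 mulr0.
Qed.

Section Quadratic.
Hypothesis rho2 : quadratic rho.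

Fact trunc_ideal_mull (a x : KQ) : (forall n, qpi (trunc (pred1 n) x) = 0) ->
  forall n, qpi (trunc (pred1 n) (a * x)) = 0.
Proof.
move=> Ix n; rewrite [a]pathalg_sumE mulr_suml linear_sum qpi_sum.
apply: big1 => p _; rewrite /= pathalg_scaleAl linearZ_LR /= qpiZ truncMl.
by case: ifP => _; rewrite ?qpiM ?qpi0 /= ?Ix !mulr0.
Qed.
Fact trunc_ideal_mulr (a x : KQ) : (forall n, qpi (trunc (pred1 n) x) = 0) ->
  forall n, qpi (trunc (pred1 n) (x * a)) = 0.
Proof.
move=> Ix n; rewrite [a]pathalg_sumE mulr_sumr linear_sum qpi_sum.
apply: big1 => p _; rewrite /= pathalg_scaleAr linearZ_LR /= qpiZ truncMr.
by case: ifP => _; rewrite ?qpiM ?qpi0 /= ?Ix ?mul0r !mulr0.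
Qed.

(** The ideal generated by homogeneous elements is homogeneous: the
    elements all of whose homogeneous parts lie in it form an ideal that
    contains the generators. *)
Lemma qpi_trunc x n : qpi x = 0 -> qpi (trunc (pred1 n) x) = 0.
Proof.
pose T x := forall n, qpi (trunc (pred1 n) x) = 0.
have T0 : T 0 by move=> m; rewrite linear0 qpi0.
have TD (y z : KQ) : T y -> T z -> T (y + z).
  by move=> Ty Tz m; rewrite linearD qpiD Ty Tz addr0.
move=> x0; apply: (@gen_ideal_ind (Ideal2 T0 TD trunc_ideal_mull trunc_ideal_mulr)
  _ x x0 n) => r rr m.
rewrite (trunc_homogeneous _ (rho2 rr)); case: eqP => _; last exact: qpi0.
exact: gen_ideal_sub.
Qed.

(** Evaluation at a vertex kills paths of length 2, hence [rho]; so it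
    descends to a character of A. *)
Lemma aug_ideal v x : qpi x = 0 -> aug v x = 0.
Proof.
have Z0 : aug v 0 = 0 :> K by exact: aug0.
have ZD (y z : KQ) : aug v y = 0 -> aug v z = 0 -> aug v (y + z) = 0.
  by move=> y0 z0; rewrite augD y0 z0 addr0.
have Zl (y z : KQ) : aug v z = 0 -> aug v (y * z) = 0.
  by move=> z0; rewrite augM z0 mulr0.
have Zr (y z : KQ) : aug v z = 0 -> aug v (z * y) = 0.
  by move=> z0; rewrite augM z0 mul0r.
apply: (@gen_ideal_ind (Ideal2 Z0 ZD Zl Zr)) => r /rho2 hr.
have /lengthsP : lengths (fun n => n = 2) r by [].
by rewrite /= aug_coef; apply.
Qed.

Definition augA v : A -> K := quot_lift (aug v).

Lemma augAE v x : augA v (qpi x) = aug v x.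
Proof.
rewrite qpiE; apply: quot_liftE => [y z|y Iy]; last by apply: aug_ideal; apply/qpi0P.
by rewrite -[X in y + X]scaleN1r augD augZ mulN1r.
Qed.

Lemma augAM v a b : augA v (a * b) = augA v a * augA v b.
Proof.
have [x <-] := qpi_surj a; have [y <-] := qpi_surj b.
by rewrite -qpiM !augAE augM.
Qed.
Lemma augAD v a b : augA v (a + b) = augA v a + augA v b.
Proof.
have [x <-] := qpi_surj a; have [y <-] := qpi_surj b.
by rewrite -qpiD !augAE augD.
Qed.
Lemma augA_scal v c : augA v (kscal A c) = c.
Proof. by rewrite qpi_scal augAE aug_scal. Qed.
Lemma augA0 v : augA v 0 = 0.
Proof. by rewrite -(rmorph0 (kscal A)) augA_scal. Qed.
Lemma augA1 v : augA v 1 = 1.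
Proof. by rewrite -(rmorph1 (kscal A)) augA_scal. Qed.
Lemma augAN v a : augA v (- a) = - augA v a.
Proof. by apply: (addrI (augA v a)); rewrite -augAD !subrr augA0. Qed.

Definition vanish_from N := forall p, (N <= plen p)%N -> qpi (pb p) = 0.

Lemma vanish_lengths N x : vanish_from N -> lengths (fun n => N <= n)%N x ->
  qpi x = 0.
Proof.
move=> vN Nx; rewrite [x]pathalg_sumE qpi_sum big_seq big1 // => p px.
by rewrite /= qpiZ vN ?mulr0 //; apply: Nx.
Qed.

(** Without constant terms, the N-th power only involves paths of length
    at least N. *)
Lemma vanish_nilp N a : vanish_from N -> (forall v, augA v a = 0) -> a ^+ N = 0.
Proof.
move=> vN; have [x <-] := qpi_surj a => ax.
rewrite -rmorphXn /=; apply: (vanish_lengths vN).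
have x1 : lengths (fun n => 0 < n)%N x.
  by apply: lengths_aug0 => v; rewrite -augAE.
elim: N {vN} => [|N IH]; first by [].
rewrite exprS; apply: (lengthsM _ x1 IH) => m n m0 Nn.
by rewrite -add1n leq_add.
Qed.

(** The kernel of each character is a maximal left ideal.  Conversely,
    if a maximal left ideal M misses an element a killed by all characters,
    then 1 = b * a + m with m in M; as b * a is nilpotent, M contains 1. *)
Lemma in_jacobsonP N a : vanish_from N ->
  in_jacobson a <-> forall v, augA v a = 0.
Proof.
move=> vN; split=> [Ja v|aug0 M [M1 maxM]].
  have Z0 : augA v (0 : A^o) = 0 by exact: augA0.
  have ZD (x y : A^o) : augA v x = 0 -> augA v y = 0 -> augA v (x + y) = 0.
    by move=> x0 y0; rewrite augAD x0 y0 addr0.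
  have Zl (c : A) (x : A^o) : augA v x = 0 -> augA v (c *: x) = 0.
    by move=> x0; rewrite augAM x0 mulr0.
  pose M := Submodule Z0 ZD Zl.
  apply: (Ja M); split; first by rewrite /= augA1; apply/eqP/oner_neq0.
  move=> N' MN'; have [NM|/existsNP[z /not_implyP[Nz /eqP Mz]]] :=
    pselect (forall z : A^o, N' z -> M z); [by right|left].
  pose e : A^o := kscal A (augA v z)^-1 *: z.
  rewrite -[1](subrK e) addrC; apply: submodD; first exact: submodZ.
  apply: MN'; rewrite /= augAD augAN augA1 augAM augA_scal mulVf //.
  exact: subrr.
apply: contrapT => Ma; apply: M1.
have Z0 : exists b (m : A^o), M m /\ (0 : A^o) = b * a + m.
  by exists 0, 0; split; [exact: submod0 | rewrite mul0r addr0].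
have ZD (x y : A^o) : (exists b (m : A^o), M m /\ x = b * a + m) ->
    (exists b (m : A^o), M m /\ y = b * a + m) ->
    exists b (m : A^o), M m /\ x + y = b * a + m.
  move=> [b [m [Mm ->]]] [b' [m' [Mm' ->]]]; exists (b + b'), (m + m').
  by split; [exact: submodD | rewrite mulrDl addrACA].
have Zl (c : A) (x : A^o) : (exists b (m : A^o), M m /\ x = b * a + m) ->
    exists b (m : A^o), M m /\ c *: x = b * a + m.
  move=> [b [m [Mm ->]]]; exists (c * b), (c *: m).
  by split; [exact: submodZ | rewrite scalerDr -mulrA].
have [m Mm|[b [m [Mm e]]]|N'M] := maxM (Submodule Z0 ZD Zl).
- by exists 0, m; rewrite mul0r add0r.
- have ba0 v : augA v (b * a) = 0 by rewrite augAM aug0 mulr0.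
  have nba := vanish_nilp vN ba0.
  (* modulo M, all powers of b * a are congruent to 1 *)
  have M1k k : M (1 - (b * a) ^+ k).
    elim: k => [|k IH]; first by rewrite expr0 subrr; exact: submod0.
    have -> : 1 - (b * a) ^+ k.+1 = m + (b * a) * (1 - (b * a) ^+ k).
      by rewrite mulrBr mulr1 -exprS addrA (addrC m) -e.
    by apply: submodD => //; exact: (submodZ (b * a) IH).
  by have := M1k N; rewrite nba subr0.
- by case: Ma; apply: N'M; exists 1, 0; split; [exact: submod0|rewrite mul1r addr0].
Qed.

End Quadratic.
End QuiverAlgebra.

(** * Finite dimension and the length grading *)

Section Paths.
Variable Q : quiver.
Implicit Types (p q : qpath Q).

Lemma path_split p k : (k <= plen p)%N ->
  exists p1 p2, plen p1 = k /\ pcomp p1 p2 = Some p.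
Proof.
move=> kp; have := qpath_ok p; rewrite -/(psrc p) -/(parr p).
rewrite -{1}(cat_take_drop k (parr p)) composable_cat => /andP[c1 c2].
exists (@QPath Q (psrc p, take k (parr p)) c1).
exists (@QPath Q (endpoint (psrc p) (take k (parr p)), drop k (parr p)) c2).
split; first by rewrite /plen /parr /= size_takel.
case: pcompP => [r _ e1 e2 _|]; last by [].
by congr Some; apply: qpathP; rewrite ?e1 ?e2 //= /parr /= cat_take_drop.
Qed.

Lemma short_paths N : exists s : seq (qpath Q), forall p, (plen p < N)%N -> p \in s.
Proof.
exists (pmap insub (flatten [seq [seq (v, val t) | v <- enum (vert Q),
  t <- enum {: k.-tuple (arr Q)}] | k <- iota 0 N])) => p pN.
rewrite mem_pmap_sub; apply/flatten_mapP; exists (plen p).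
  by rewrite mem_iota.
apply/allpairsP; exists (psrc p, in_tuple (parr p)); rewrite !mem_enum.
by split=> //; case: p {pN} => -[].
Qed.

End Paths.

Section QuiverAlgebra.
Variables (K : fieldType) (Q : quiver) (rho : pathalg K Q -> Prop).
Notation KQ := (pathalg K Q).
Notation pb := (pbasis K).
Notation A := (quiver_alg rho).
Notation pi := (qpi rho).
Implicit Types (p q : qpath Q) (x y : KQ) (a b : A).
Hypothesis rho2 : quadratic rho.

(** If A has dimension at most n, nonzero paths of the n + 1 lengths
    0, .., n would be linearly dependent, against the grading.  So the paths of
    some length k vanish, and with them all longer ones. *)
Lemma vanish_from_findim : finite_dimensional A -> exists N, vanish_from rho N.
Proof.
move=> [n [b bP]].
have [k kn vk] : exists2 k, (k <= n)%N & forall p, plen p = k -> pi (pb p) = 0.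
  apply: contrapT => nk.
  have ex (k : 'I_n.+1) : exists p, plen p = k /\ pi (pb p) <> 0.
    apply: contrapT => nk'; apply: nk; exists k => [|p pk]; first by rewrite -ltnS.
    by apply: contrapT => np; apply: nk'; exists p.
  case/choice: ex => p pP.
  have /choice[c cP] := fun k => bP (pi (pb (p k))) I.
  pose C := \matrix_(k < n.+1, i < n) c k i.
  have /rowV0Pn[v /sub_kermxP vC /eqP v0] : kermx C != 0.
    rewrite -mxrank_eq0 mxrank_ker subn_eq0 -ltnNge.
    exact: leq_ltn_trans (rank_leq_col _) (ltnSn n).
  apply: v0; apply/rowP => k; rewrite mxE.
  pose x : KQ := \sum_k v 0 k *: pb (p k).
  have x0 : pi x = 0.
    rewrite qpi_sum.
    under eq_bigr do rewrite qpiZ cP mulr_sumr.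
    rewrite exchange_big big1 //= => i _.
    have -> : \sum_k kscal A (v 0 k) * (kscal A (c k i) * b i) =
              kscal A (\sum_k v 0 k * c k i) * b i.
      rewrite (rmorph_sum (kscal A)) mulr_suml; apply: eq_bigr => j _.
      by rewrite (rmorphM (kscal A)) mulrA.
    have -> : \sum_k v 0 k * c k i = 0.
      move/rowP/(_ i): vC; rewrite !mxE => e; rewrite -[RHS]e.
      by apply: eq_bigr => j _; rewrite mxE.
    by rewrite rmorph0 mul0r.
  have := qpi_trunc rho2 k x0; rewrite linear_sum (bigD1 k) //= big1 ?addr0.
    rewrite linearZ_LR /= trunc_pbasis /= (pP k).1 eqxx qpiZ => vp0.
    apply/eqP/negP => /negP vk0; case: (pP k) => _; apply.
    exact: kscal_inj0 vk0 vp0.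
  move=> j jk; rewrite linearZ_LR /= trunc_pbasis /= (pP j).1.
  by case: eqP => [/val_inj /eqP|_]; rewrite ?(negPf jk) ?scaler0.
exists k => p /path_split[p1 [p2 [p1k e]]].
have -> : pb p = pb p1 * pb p2 by rewrite pathalg_mul_pbasis e.
by rewrite qpiM; exact: etrans (congr1 ( *%R^~ _) (vk _ p1k)) (mul0r _).
Qed.

Lemma findim_vanish_from N : vanish_from rho N -> finite_dimensional A.
Proof.
move=> vN; have [s0 s0P] := short_paths Q N.
pose s := undup s0; have us : uniq s := undup_uniq s0.
pose b (i : 'I_(size s)) : A := pi (pb (tnth (in_tuple s) i)).
exists (size s), b => a _; have [x <-] := qpi_surj a.
pose y : KQ := \sum_(p <- s) (x : {malg K[qpath Q]})@_p *: pb p.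
exists (fun i => (x : {malg K[qpath Q]})@_(tnth (in_tuple s) i)).
have -> : pi x = pi y.
  apply/eqP; rewrite -subr_eq0 -qpiB; apply/eqP; apply: (vanish_lengths vN).
  apply/lengthsP => p /negP; rewrite -ltnNge => /s0P ps.
  rewrite [LHS]mcoeffB; apply/eqP; rewrite subr_eq0 /y (raddf_sum (mcoeff p)) /=.
  rewrite (bigD1_seq p) ?mem_undup //= big1 ?addr0 => [|q qp].
    by rewrite mcoeffZ coef_pbasis eqxx mulr1.
  by rewrite mcoeffZ coef_pbasis (negPf qp) mulr0.
rewrite /y qpi_sum (big_tnth _ _ s); apply: eq_bigr => i _.
by rewrite qpiZ.
Qed.

Notation gr := (@length_grading K Q rho).

Lemma length_grading_scal n c a : gr n a -> gr n (kscal A c * a).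
Proof.
by move=> /length_gradingP[x hx <-]; apply/length_gradingP; exists (c *: x); [by rewrite homogeneousE; exact: lengthsZ | rewrite -qpiZ].
Qed.

Lemma length_grading_grading : grading gr.
Proof.
split.
- move=> n; apply/length_gradingP.
  by exists 0; [rewrite homogeneousE; exact: lengths0 | exact: qpi0].
- move=> n _ _ /length_gradingP[x hx <-] /length_gradingP[y hy <-].
  apply/length_gradingP; exists (x + y); first by rewrite homogeneousE; exact: lengthsD.
  exact: qpiD.
- exact: length_grading_scal.
- apply/length_gradingP; exists 1; last exact: qpi1.
  by rewrite homogeneousE; apply: lengths_sum => v; apply: lengths_pbasis.
- move=> m n _ _ /length_gradingP[x hx <-] /length_gradingP[y hy <-].
  apply/length_gradingP; exists (x * y); last exact: qpiM.
  rewrite homogeneousE.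
  by apply: (lengthsM (P1 := eq^~ m) (P2 := eq^~ n) _ hx hy) => i j -> ->.
- move=> a; have [x <-] := qpi_surj a; have [N xN] := lengths_bound x.
  exists N, (fun n => pi (trunc (pred1 n) x)); split.
    by move=> n; apply/length_gradingP; exists (trunc (pred1 n) x) => //; apply: homogeneous_trunc.
  by rewrite {1}(trunc_sum xN) qpi_sum.
- move=> N f fgr; have /choice[x xP] :
      forall n, exists x, homogeneous n x /\ f n = pi x.
    by move=> n; have /length_gradingP[x hx <-] := fgr n; exists x.
  under eq_bigr => n _ do rewrite (xP n).2.
  rewrite -qpi_sum => x0 n nN; have := qpi_trunc rho2 n x0.
  rewrite linear_sum (bigD1 (Ordinal nN)) //= big1 => [|i ni].
    by rewrite addr0 (trunc_homogeneous _ (xP n).1) eqxx -(xP n).2.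
  rewrite (trunc_homogeneous _ (xP i).1); case: eqP => // ein.
  by case/eqP: ni; apply: val_inj.
Qed.

(** The scalar is absorbed by the first arrow. *)
Lemma path_prod n p c : plen p = n.+1 ->
  exists a : 'I_n.+1 -> A, (forall k, gr 1%N (a k)) /\
    kscal A c * pi (pb p) = \prod_k a k.
Proof.
elim: n p c => [|n IH] p c pn.
  exists (fun=> kscal A c * pi (pb p)); rewrite big_ord1; split=> // _.
  by apply: length_grading_scal; apply/length_gradingP; exists (pb p) => //; rewrite homogeneousE; apply: lengths_pbasis.
have [|p1 [p2 [p1n e]]] := @path_split _ p 1%N; first by rewrite pn.
have [|a [ga ea]] := IH p2 1.
  by apply/eqP; rewrite -(eqn_add2l 1) -{1}p1n -(plen_pcomp e) pn.
exists (fun k => if unlift ord0 k is Some j then a j else kscal A c * pi (pb p1)).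
split=> [k|].
  case: unliftP => [j _|_]; first exact: ga.
  by apply: length_grading_scal; apply/length_gradingP; exists (pb p1) => //; rewrite homogeneousE; apply: lengths_pbasis.
rewrite big_ord_recl unlift_none; under eq_bigr do rewrite liftK.
rewrite -ea rmorph1 mul1r -mulrA -qpiM; congr (_ * pi _).
by rewrite pathalg_mul_pbasis e.
Qed.

Lemma length_grading_generated : generated_in_degrees_01 gr.
Proof.
move=> [//|n] _ _ /length_gradingP[x hx <-].
pose m := size (msupp x); pose p (j : 'I_m) := tnth (in_tuple (msupp x)) j.
have /choice[a aP] : forall j : 'I_m, exists a : 'I_n.+1 -> A,
    (forall k, gr 1%N (a k)) /\
    kscal A (x : {malg K[qpath Q]})@_(p j) * pi (pb (p j)) = \prod_k a k.
  by move=> j; apply: path_prod; apply: hx; apply: mem_tnth.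
exists m, a; split=> [j k|]; first exact: (aP j).1.
rewrite {1}[x]pathalg_sumE qpi_sum big_tnth.
by apply: eq_bigr => j _; rewrite -(aP j).2 qpiZ.
Qed.

Lemma trivial_pathM (v w : vert Q) : pb (ptriv v) * pb (ptriv w) =
  if v == w then pb (ptriv v) else 0.
Proof.
rewrite pathalg_mul_pbasis pcomp_trivl -[psrc (ptriv w)]/w.
by have [->|_] := eqVneq v w.
Qed.

Lemma length_grading_degree0 : (0 < #|vert Q|)%N ->
  exists r' (f : {ffun 'I_r'.+1 -> K} -> A),
    [/\ forall (c : K) (x y : {ffun 'I_r'.+1 -> K}),
          f ([ffun i => c * x i] + y) = kscal A c * f x + f y,
        f 1 = 1, {morph f : x y / x * y}, injective f &
        forall a, gr 0%N a <-> exists z, f z = a].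
Proof.
move=> Q0; pose r' := #|vert Q|.-1.
have e : #|vert Q| = r'.+1 by rewrite prednK.
pose rk v := cast_ord e (enum_rank v).
pose un i := enum_val (cast_ord (esym e) i).
have rkK : cancel rk un by move=> v; rewrite /rk /un cast_ordK enum_rankK.
have unK : cancel un rk by move=> i; rewrite /rk /un enum_valK cast_ordKV.
pose g (x : {ffun 'I_r'.+1 -> K}) : KQ := \sum_v x (rk v) *: pb (ptriv v).
have augg (v : vert Q) z : aug v (g z) = z (rk v).
  rewrite aug_sum (bigD1 v) //= big1 => [|w wv]; last first.
    by rewrite augZ aug_pbasis (inj_eq (@ptriv_inj _)) (negPf wv) mulr0.
  by rewrite augZ aug_pbasis eqxx mulr1 addr0.
exists r', (pi \o g); split=> /=.
- move=> c x y; rewrite -qpiZ -qpiD; congr (pi _); rewrite /g scaler_sumr.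
  rewrite -big_split; apply: eq_bigr => v _ /=.
  by rewrite !ffunE scalerDl scalerA.
- rewrite -(qpi1 rho); congr (pi _); apply: eq_bigr => v _.
  by rewrite ffunE scale1r.
- move=> x y; rewrite -qpiM; congr (pi _); rewrite /g mulr_suml.
  apply: eq_bigr => v _; rewrite mulr_sumr (bigD1 v) //= big1 => [|w wv].
    by rewrite pathalg_scaleAl pathalg_scaleAr trivial_pathM eqxx addr0 scalerA ffunE.
  rewrite pathalg_scaleAl pathalg_scaleAr trivial_pathM eq_sym (negPf wv).
  by rewrite !scaler0.
- move=> x y exy; apply/ffunP => i.
  have exy' : aug (un i) (g x) = aug (un i) (g y).
    exact: etrans (esym (augAE rho2 _ _)) (etrans (congr1 _ exy) (augAE rho2 _ _)).
  by have := etrans (esym (augg _ x)) (etrans exy' (augg _ y)); rewrite unK.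
- move=> a; split=> [/length_gradingP[y hy <-]|[x <-]]; last first.
    apply/length_gradingP; exists (g x) => //; rewrite homogeneousE; apply: lengths_sum => v; apply: lengthsZ.
    exact: lengths_pbasis.
  exists [ffun i => aug (un i) y]; congr (pi _); apply/malgP => p.
  have [p0|p0] := eqVneq (plen p) 0%N.
    by rewrite (plen0 p0) -aug_coef augg ffunE rkK aug_coef.
  have /lengthsP -> : lengths (eq^~ 0%N) (g [ffun i => aug (un i) y]).
  - by apply: lengths_sum => v; apply: lengthsZ; apply: lengths_pbasis.
  - have /lengthsP -> // : lengths (fun n => n = 0%N) y by [].
    exact/eqP.
  - exact/eqP.
Qed.

Lemma quadratic_graded_quiver_algebra :
  (0 < #|vert Q|)%N -> finite_dimensional A -> graded_quiver_algebra gr.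
Proof.
move=> Q0 [n [b bP]]; split.
- exact: length_grading_grading.
- exact: length_grading_generated.
- exact: length_grading_degree0.
- by move=> m; exists n, b => a _; apply: bP.
Qed.

End QuiverAlgebra.

(** * Unique path lifting *)

Section PathLifting.
Variables (Q' Q : quiver) (F : qmorphism Q' Q).

Lemma map_path_triv v' : map_path F (ptriv v') = ptriv (fvert F v').
Proof. exact: qpathP. Qed.

Lemma ptgt_map_path p' : ptgt (map_path F p') = fvert F (ptgt p').
Proof.
rewrite /ptgt /endpoint /psrc /parr /= -map_comp.
rewrite (eq_map (g := fvert F \o @tgt Q')) => [|a]; last exact: ftgt.
by rewrite map_comp last_map.
Qed.

Lemma plen_map_path p' : plen (map_path F p') = plen p'.
Proof. exact: size_map. Qed.

Lemma pcomp_map_path p' q' r' : pcomp p' q' = Some r' ->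
  pcomp (map_path F p') (map_path F q') = Some (map_path F r').
Proof.
case: pcompP => // s e e1 e2 e3 [<-]; case: pcompP => [t _ f1 f2 _|].
  congr Some; apply: qpathP; first by rewrite f1 /psrc /= -/(psrc _) -/(psrc _) e1.
  by rewrite f2 /parr /= -/(parr _) -/(parr _) -/(parr _) e2 map_cat.
by rewrite ptgt_map_path e.
Qed.

Hypothesis covF : covering F.

Lemma composable_lift v' s : composable (fvert F v') s ->
  exists s', composable v' s' /\ map (farr F) s' = s.
Proof.
have [_ lift_arr _] := covF.
elim: s v' => [|a s IH] v' /=; first by exists [::].
case/andP=> /eqP /lift_arr[a' [[sa' <-] _]]; rewrite ftgt => /IH[s' [cs' <-]].
by exists (a' :: s'); rewrite /= sa' eqxx.
Qed.

Lemma composable_lift_uniq v' s1 s2 : composable v' s1 -> composable v' s2 ->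
  map (farr F) s1 = map (farr F) s2 -> s1 = s2.
Proof.
have [_ lift_arr _] := covF.
elim: s1 s2 v' => [|a s1 IH] [|b s2] v' //= /andP[/eqP sa c1] /andP[/eqP sb c2].
case=> ab e.
have [a' [_ ua']] := lift_arr v' (farr F a) (etrans (fsrc F a) (congr1 _ sa)).
have eab : a = b by rewrite -(ua' a) ?(ua' b).
by rewrite eab in c1 *; rewrite (IH s2 (tgt b)).
Qed.

(** A lifting L enters [lift_path] only through its value at the initial vertex
    of the path; here the initial vertex v' of the lift is the parameter.  For
    paths that do not start at F v' the value is the trivial path at v'. *)
Definition plift v' (p : qpath Q) : qpath Q' :=
  xget (ptriv v') [set p' | psrc p' = v' /\ map_path F p' = p]%classic.

Lemma lift_pathE L p : lift_path F L p = plift (L (psrc p)) p.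
Proof. by []. Qed.

Lemma pliftP v' p : psrc p = fvert F v' ->
  psrc (plift v' p) = v' /\ map_path F (plift v' p) = p.
Proof.
move=> pv; have := qpath_ok p; rewrite -/(psrc p) -/(parr p) pv.
case/composable_lift => s' [cs' es'].
rewrite /plift; case: xgetP => [p' _ []//|nex].
case: (nex (@QPath Q' (v', s') cs')); split=> //.
by apply: qpathP; rewrite /psrc /parr //= -es'.
Qed.

Lemma psrc_plift v' p : psrc p = fvert F v' -> psrc (plift v' p) = v'.
Proof. by case/pliftP. Qed.
Lemma map_plift v' p : psrc p = fvert F v' -> map_path F (plift v' p) = p.
Proof. by case/pliftP. Qed.

Lemma plift_uniq v' p p' : psrc p' = v' -> map_path F p' = p -> plift v' p = p'.
Proof.
move=> sp' mp'; have e : psrc p = fvert F v' by rewrite -mp' -sp'.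
have [s1 m1] := pliftP e; apply: qpathP; first by rewrite s1.
have c1 := qpath_ok (plift v' p); have c2 := qpath_ok p'.
apply: (composable_lift_uniq (v' := v')).
- by rewrite -{1}s1.
- by rewrite -{1}sp'.
- by have := congr1 (@parr Q) m1; rewrite -mp'.
Qed.

Lemma ptgt_plift v' p : psrc p = fvert F v' -> fvert F (ptgt (plift v' p)) = ptgt p.
Proof. by move=> e; rewrite -ptgt_map_path map_plift. Qed.

Lemma plift_triv v' : plift v' (ptriv (fvert F v')) = ptriv v'.
Proof. by apply: plift_uniq => //; apply: map_path_triv. Qed.

Lemma plift_pcomp v' p q r : psrc p = fvert F v' -> pcomp p q = Some r ->
  pcomp (plift v' p) (plift (ptgt (plift v' p)) q) = Some (plift v' r).
Proof.
move=> pv; case epq: _ / pcompP => [s tp s1 s2 s3|//] [<-].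
have qv : psrc q = fvert F (ptgt (plift v' p)) by rewrite ptgt_plift.
case e: (pcomp _ _) => [r'|]; last first.
  by move: e; case: pcompP => // ne; case: ne; rewrite psrc_plift.
congr Some; apply/esym/plift_uniq.
  by move: e; case: pcompP => // t _ t1 _ _ [<-]; rewrite t1 psrc_plift.
have := pcomp_map_path e; rewrite !map_plift // => e'.
by move: e'; case: pcompP => // t _ t1 t2 _ [<-]; apply: qpathP;
  rewrite ?t1 ?t2 ?s1 ?s2.
Qed.

End PathLifting.

(** * Transfer and folding between the path algebras of a covering *)

(** The transfer map of the covering, a ring morphism against its direction. *)
HB.lock Definition total_lift (K : fieldType) (Q' Q : quiver)
  (F : qmorphism Q' Q) (x : pathalg K Q) : pathalg K Q' :=
  linext (fun p => \sum_(v' | fvert F v' == psrc p) pbasis K (plift F v' p)) x.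

(** The (i, j) entry of the matrix by which [x] acts on pulled back modules. *)
HB.lock Definition entry (K : fieldType) (Q' Q : quiver) (F : qmorphism Q' Q)
  (i j : vert Q') (x : pathalg K Q') : pathalg K Q :=
  map_pathalg F (component i j x).

Section Covering.
Variables (K : fieldType) (Q' Q : quiver) (F : qmorphism Q' Q).
Notation KQ := (pathalg K Q).
Notation KQ' := (pathalg K Q').
Notation pb := (pbasis K).
Notation lift := (@total_lift K Q' Q F).
Notation entry := (@entry K Q' Q F).
Implicit Types (p q : qpath Q) (i j k : vert Q').

Fact total_lift_linear : linear lift.
Proof. by move=> a x y; rewrite unlock; exact: linext_linear. Qed.
HB.instance Definition _ := GRing.isLinear.Build K KQ KQ' _ lift total_lift_linear.

Fact entry_linear i j : linear (entry i j).
Proof.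
move=> a x y; rewrite unlock /map_pathalg /component.
by rewrite !(linext_linear _ a).
Qed.
HB.instance Definition _ i j :=
  GRing.isLinear.Build K KQ' KQ _ (entry i j) (entry_linear i j).

Lemma entryE i j (x : KQ') : entry i j x = map_pathalg F (component i j x).
Proof. by rewrite unlock. Qed.

Lemma total_lift_pbasis p :
  lift (pb p) = \sum_(v' | fvert F v' == psrc p) pb (plift F v' p).
Proof. by rewrite unlock; exact: linextU. Qed.

Lemma entry_pbasis i j (p' : qpath Q') : entry i j (pb p') =
  if (psrc p' == i) && (ptgt p' == j) then pb (map_path F p') else 0.
Proof.
rewrite unlock /component linextU; case: ifP => _; first exact: linextU.
exact: linear0.
Qed.

Lemma entryM i j (x y : KQ') :
  entry i j (x * y) = \sum_k entry i k x * entry k j y.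
Proof.
move: x; apply: pathalg_ext => [a x x'|a x x'|p'].
- by rewrite mulrDl pathalg_scaleAl linearP.
- rewrite scaler_sumr -big_split; apply: eq_bigr => k _ /=.
  by rewrite linearP mulrDl pathalg_scaleAl.
move: y; apply: pathalg_ext => [a y y'|a y y'|q'].
- by rewrite mulrDr pathalg_scaleAr linearP.
- rewrite scaler_sumr -big_split; apply: eq_bigr => k _ /=.
  by rewrite linearP mulrDr pathalg_scaleAr.
rewrite (bigD1 (ptgt p')) //= big1 ?addr0 => [|k kp]; last first.
  by rewrite entry_pbasis [_ == k]eq_sym (negPf kp) andbF mul0r.
rewrite pathalg_mul_pbasis entry_pbasis [X in _ = _ * X]entry_pbasis eqxx andbT.
case e: (pcomp p' q') => [r|] /=; last first.
  have -> : (psrc q' == ptgt p') = false.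
    by apply/eqP => qp; move: e; case: pcompP => // ne; case: ne.
  by rewrite linear0 mulr0.
have [sr tr ->] : [/\ psrc r = psrc p', ptgt r = ptgt q' & psrc q' = ptgt p'].
  by move: e; case: pcompP => // s e1 e2 _ e3 [<-].
rewrite entry_pbasis sr tr eqxx /=; case: (psrc p' == i); case: (ptgt q' == j) => /=;
  rewrite ?mulr0 ?mul0r //.
by rewrite pathalg_mul_pbasis (pcomp_map_path F e).
Qed.

Lemma entry1 i j : entry i j 1 = if i == j then pb (ptriv (fvert F i)) else 0.
Proof.
rewrite [1]/(pone K Q') linear_sum (bigD1 i) //= big1 ?addr0 => [|k ki].
  by rewrite entry_pbasis map_path_triv eqxx.
by rewrite entry_pbasis [_ == i](negPf ki).
Qed.

Lemma entry_ptriv i j k : entry j k (pb (ptriv i)) =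
  if (j == i) && (k == i) then pb (ptriv (fvert F i)) else 0.
Proof.
by rewrite entry_pbasis map_path_triv !(eq_sym i).
Qed.

(** Off the diagonal the entries have no constant term, as trivial paths
    are loops; on the diagonal they keep that of [x]. *)
Lemma aug_entry v i j (x : KQ') : aug v (entry i j x) =
  if (i == j) && (fvert F i == v) then aug i x else 0.
Proof.
move: x; apply: (pathalg_ext (V := K^o) (f := fun x => aug v (entry i j x))
  (g := fun x => if (i == j) && (fvert F i == v) then aug i x else 0))
  => [a x y|a x y|p'].
- by rewrite linearP augD augZ.
- by rewrite augD augZ; case: ifP => //; rewrite scaler0 addr0.
rewrite entry_pbasis aug_pbasis.
have [p0|p0] := eqVneq (plen p') 0%N.
  rewrite (plen0 p0); move: (psrc p') => w'; rewrite (inj_eq (@ptriv_inj _)).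
  rewrite -[psrc (ptriv w')]/w' -[ptgt (ptriv w')]/w' map_path_triv.
  case: (eqVneq w' i) => [->|wi] /=; last by rewrite aug0 if_same.
  case: (eqVneq i j) => [->|ij] /=; last by rewrite aug0.
  by rewrite aug_pbasis (inj_eq (@ptriv_inj _)); case: eqP.
have np (R : quiver) (r : qpath R) u : plen r != 0%N -> (r == ptriv u) = false.
  by apply: contraNF => /eqP->.
rewrite (np _ _ _ p0) if_same; case: ifP => _; last by rewrite aug0.
by rewrite aug_pbasis np ?plen_map_path.
Qed.

Section Lift.
Hypothesis covF : covering F.

(** For each lift of p, exactly one lift of q starts where it ends. *)
Lemma total_liftM (x y : KQ) : lift (x * y) = lift x * lift y.
Proof.
move: x; apply: pathalg_ext => [a x x'|a x x'|p].
- by rewrite mulrDl pathalg_scaleAl linearP.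
- by rewrite linearP mulrDl pathalg_scaleAl.
move: y; apply: pathalg_ext => [a y y'|a y y'|q].
- by rewrite mulrDr pathalg_scaleAr linearP.
- by rewrite linearP mulrDr pathalg_scaleAr.
have tp v' : fvert F v' == psrc p -> fvert F (ptgt (plift F v' p)) = ptgt p.
  by move/eqP/esym; exact: ptgt_plift.
have sq w' : fvert F w' == psrc q -> psrc (plift F w' q) = w'.
  by move/eqP/esym; exact: psrc_plift.
rewrite pathalg_mul_pbasis (total_lift_pbasis p) mulr_suml.
case e: (pcomp p q) => [r|] /=; last first.
  rewrite linear0 big1 // => v' pv; rewrite total_lift_pbasis mulr_sumr big1 //.
  move=> w' qw; rewrite pathalg_mul_pbasis; case: pcompP => //= s.
  rewrite sq // => tw; move: e; case: pcompP => // ne; case: ne.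
  by rewrite -(tp _ pv) tw (eqP qw).
have [sr tq] : psrc r = psrc p /\ ptgt p = psrc q.
  by move: e; case: pcompP => // s e1 e2 _ _ [<-].
rewrite total_lift_pbasis sr; apply: eq_bigr => v' pv.
rewrite total_lift_pbasis mulr_sumr (bigD1 (ptgt (plift F v' p))) /=; last first.
  by rewrite tp // tq.
rewrite pathalg_mul_pbasis (plift_pcomp covF (esym (eqP pv)) e) /= big1 ?addr0 //.
move=> w' /andP[qw wt]; rewrite pathalg_mul_pbasis; case: pcompP => //= s.
by rewrite sq // => tw; case/eqP: wt.
Qed.

Lemma total_lift1 : lift 1 = 1.
Proof.
rewrite [1 in LHS]/(pone K Q) [1 in RHS]/(pone K Q') linear_sum /pone.
rewrite (partition_big (fvert F) predT) //=; apply: eq_bigr => v _.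
rewrite total_lift_pbasis; apply: eq_bigr => v' /eqP e.
by rewrite -[v]/(psrc (ptriv v)) -e plift_triv.
Qed.

Lemma ptriv_total_lift i p : pb (ptriv i) * lift (pb p) =
  if fvert F i == psrc p then pb (plift F i p) else 0.
Proof.
have m v' : fvert F v' == psrc p -> pb (ptriv i) * pb (plift F v' p) =
    if i == v' then pb (plift F v' p) else 0.
  move=> /eqP/esym pv; rewrite pathalg_mul_pbasis pcomp_trivl psrc_plift //.
  by case: (i == v').
rewrite total_lift_pbasis mulr_sumr; case: ifP => pi.
  rewrite (bigD1 i) //= big1 ?addr0 => [|k /andP[pk ki]]; first by rewrite m // eqxx.
  by rewrite m // eq_sym (negPf ki).
rewrite big1 // => k pk; rewrite m //; case: eqP => // ik.
by rewrite ik pk in pi.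
Qed.

(** The row of i sees only the lifts that start at i; there is one for
    each path that starts at F(i), and it is pushed down to that path. *)
Lemma entry_row_sum i (x : KQ) :
  \sum_j entry i j (lift x) = pb (ptriv (fvert F i)) * x.
Proof.
move: x; apply: pathalg_ext => [a x y|a x y|p].
- rewrite scaler_sumr -big_split; apply: eq_bigr => k _ /=.
  by rewrite !linearP.
- by rewrite mulrDr pathalg_scaleAr.
rewrite total_lift_pbasis; under eq_bigr do rewrite linear_sum.
rewrite exchange_big /= pathalg_mul_pbasis pcomp_trivl.
have m v' : fvert F v' == psrc p ->
    \sum_j entry i j (pb (plift F v' p)) = if v' == i then pb p else 0.
  move=> /eqP/esym pv; rewrite (bigD1 (ptgt (plift F v' p))) //=.
  rewrite big1 ?addr0 => [|k kp]; rewrite entry_pbasis psrc_plift //.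
    by rewrite eqxx andbT map_plift.
  by rewrite [_ == k]eq_sym (negPf kp) andbF.
case: ifP => pi.
  rewrite (bigD1 i) //= m // eqxx [X in _ + X]big1 ?addr0 // => k /andP[pk ki].
  by rewrite m // (negPf ki).
rewrite big1 // => k pk; rewrite m //; case: eqP => // ik.
by rewrite -ik pk in pi.
Qed.

(** By unique lifting, a path p' of Q' is the only lift of its push-down that
    starts where p' does. *)
Lemma lift_entry_col_sum j (x : KQ') :
  \sum_i pb (ptriv i) * lift (entry i j x) = x * pb (ptriv j).
Proof.
move: x; apply: pathalg_ext => [a x y|a x y|p'].
- rewrite scaler_sumr -big_split; apply: eq_bigr => k _ /=.
  by rewrite !linearP mulrDr pathalg_scaleAr.
- by rewrite mulrDl pathalg_scaleAl.
rewrite pathalg_mul_pbasis pcomp_trivr (bigD1 (psrc p')) //= big1 ?addr0.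
  rewrite entry_pbasis eqxx eq_sym /=; case: eqP => _; last by rewrite linear0 mulr0.
  by rewrite ptriv_total_lift eqxx (plift_uniq covF (erefl _) (erefl _)).
by move=> k kp; rewrite entry_pbasis eq_sym (negPf kp) linear0 mulr0.
Qed.

Lemma aug_total_lift i (x : KQ) : aug i (lift x) = aug (fvert F i) x.
Proof.
move: x; apply: (pathalg_ext (V := K^o) (f := fun x => aug i (lift x))
  (g := fun x => aug (fvert F i) x)) => [a x y|a x y|p].
- by rewrite linearP augD augZ.
- by rewrite augD augZ.
rewrite -[LHS]mul1r -{1}(aug1 K i).
have -> : aug i (1 : KQ') = aug i (pb (ptriv i)) by rewrite aug1 aug_pbasis eqxx.
rewrite -augM ptriv_total_lift aug_pbasis; case: eqP => pi; last first.
  by rewrite aug0; case: eqP => // ep; case: pi; rewrite ep.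
rewrite aug_pbasis; congr ((nat_of_bool _)%:R); apply/eqP/eqP => e.
  by rewrite -(map_plift covF (esym pi)) e map_path_triv.
by rewrite e plift_triv.
Qed.

End Lift.
End Covering.

(** * The covering of a quadratic algebra *)

Section QuotientModuleMaps.
Variables (R : pzRingType) (V W : lmodType R) (N : submodule V).

Lemma quotmod_lift (f : {linear V -> W}) : (forall x, N x -> f x = 0) ->
  exists g : {linear quotmod N -> W}, forall x, g (quotpi N x) = f x.
Proof.
move=> fN; pose g (q : quotmod N) := f (projT1 (cid (quotpi_surj q))).
have gE x : g (quotpi N x) = f x.
  rewrite /g; case: cid => y /= /quotpi_eq Nyx.
  by apply/eqP; rewrite -subr_eq0 -linearB fN.
have lg : linear g.
  move=> a x y; have [{}x <-] := quotpi_surj x; have [{}y <-] := quotpi_surj y.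
  by rewrite -quotpiZ -quotpiD !gE linearP.
pose g' : {linear quotmod N -> W} :=
  HB.pack g (GRing.isLinear.Build R (quotmod N) W _ g lg).
by exists g'.
Qed.

End QuotientModuleMaps.

Section RelationCovering.
Variables (K : fieldType) (Q' Q : quiver) (F : qmorphism Q' Q).
Variables (rho : pathalg K Q -> Prop) (rho' : pathalg K Q' -> Prop).
Notation KQ := (pathalg K Q).
Notation KQ' := (pathalg K Q').
Notation pb := (pbasis K).
Notation lift := (@total_lift K Q' Q F).
Notation entry := (@entry K Q' Q F).
Notation A := (quiver_alg rho).
Notation A' := (quiver_alg rho').
Notation pi := (qpi rho).
Notation pi' := (qpi rho').
Implicit Types (i j k : vert Q').
Hypothesis covF : relation_covering rho' rho F.
Hypothesis rho2 : quadratic rho.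

Let cov : covering F. Proof. by have [[]] := covF. Qed.

Lemma plen_plift v' p : psrc p = fvert F v' -> plen (plift F v' p) = plen p.
Proof. by move=> e; rewrite -(plen_map_path F) map_plift. Qed.

Lemma lift_pathalg_pbasis L p :
  lift_pathalg F L (pb p) = pb (plift F (L (psrc p)) p).
Proof. exact: linextU. Qed.

Lemma quadratic_lift : quadratic rho'.
Proof.
move=> r' /(rc_lift covF)[L [r [FL rr ->]]]; rewrite homogeneousE.
rewrite /lift_pathalg /linext; apply: lengths_sum_seq => p pr.
apply: lengthsZ; apply: lengths_pbasis; rewrite lift_pathE plen_plift ?FL //.
exact: rho2 pr.
Qed.
Notation rho2' := quadratic_lift.

Section LiftThrough.
Variable i0 : vert Q'.

Lemma lifting_through : exists L, is_lifting F L /\ L (fvert F i0) = i0.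
Proof.
have [/choice[s sP] _ _] := cov.
exists (fun v => if v == fvert F i0 then i0 else s v); rewrite eqxx.
by split=> // v; case: eqP => [->|_].
Qed.

(** Only the lifts that start at i0 survive the multiplication, and these
    are the lifts with respect to any lifting through i0. *)
Lemma ptriv_total_lift_rel r : rho r -> pi' (pb (ptriv i0) * lift r) = 0.
Proof.
move=> rr; have [L [FL Li0]] := lifting_through.
have -> : pb (ptriv i0) * lift r = pb (ptriv i0) * lift_pathalg F L r.
  move: r {rr}; apply: pathalg_ext => [a x y|a x y|p].
  - by rewrite linearP mulrDr pathalg_scaleAr.
  - by rewrite /lift_pathalg linearP mulrDr pathalg_scaleAr.
  rewrite (ptriv_total_lift K cov) /lift_pathalg linextU lift_pathE.
  rewrite pathalg_mul_pbasis pcomp_trivl psrc_plift ?FL //.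
  case: eqP => [<-|ne]; first by rewrite Li0 eqxx.
  by case: eqP => // iL; case: ne; rewrite iL FL.
have rr' : rho' (lift_pathalg F L r) by apply/(rc_lift covF); exists L, r.
by rewrite qpiM (gen_ideal_sub rr') mulr0.
Qed.

End LiftThrough.

Lemma total_lift_rel r : rho r -> pi' (lift r) = 0.
Proof.
move=> rr; rewrite -[lift r]mul1r [1]/(pone K Q') mulr_suml qpi_sum big1 // => i _.
exact: ptriv_total_lift_rel.
Qed.

Lemma total_lift_ideal (x : KQ) : pi x = 0 -> pi' (lift x) = 0.
Proof.
have Z0 : pi' (lift 0) = 0 by rewrite linear0 qpi0.
have ZD (y z : KQ) : pi' (lift y) = 0 -> pi' (lift z) = 0 -> pi' (lift (y + z)) = 0.
  by move=> y0 z0; rewrite linearD qpiD y0 z0 addr0.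
have Zl (y z : KQ) : pi' (lift z) = 0 -> pi' (lift (y * z)) = 0.
  by move=> z0; rewrite (total_liftM cov) qpiM z0 mulr0.
have Zr (y z : KQ) : pi' (lift z) = 0 -> pi' (lift (z * y)) = 0.
  by move=> z0; rewrite (total_liftM cov) qpiM z0 mul0r.
apply: (@gen_ideal_ind _ _ _ (Ideal2 Z0 ZD Zl Zr)) => r; exact: total_lift_rel.
Qed.

Lemma component_mul v w (x : KQ) :
  component v w x = pb (ptriv v) * x * pb (ptriv w).
Proof.
move: x; apply: pathalg_ext => [a x y|a x y|p].
- exact: linext_linear.
- by rewrite mulrDr pathalg_scaleAr mulrDl pathalg_scaleAl.
rewrite /component linextU pathalg_mul_pbasis pcomp_trivl eq_sym.
case: eqP => _ /=; last by rewrite mul0r.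
by rewrite pathalg_mul_pbasis pcomp_trivr eq_sym; case: eqP.
Qed.

Lemma map_lift_pathalg L (x : KQ) : is_lifting F L ->
  map_pathalg F (lift_pathalg F L x) = x.
Proof.
move=> FL; move: x; apply: pathalg_ext => [a x y|//|p].
  by rewrite /lift_pathalg /map_pathalg !(linext_linear _ a).
by rewrite /lift_pathalg linextU /map_pathalg linextU lift_pathE map_plift ?FL.
Qed.

(** The lift of a path with respect to L contributes to exactly one
    entry. *)
Lemma entry_lift_coef L (x : KQ) i j p : is_lifting F L ->
  (entry i j (lift_pathalg F L x) : {malg K[qpath Q]})@_p =
  if (L (psrc p) == i) && (ptgt (plift F (L (psrc p)) p) == j)
  then (x : {malg K[qpath Q]})@_p else 0.
Proof.
move=> FL; pose c p := (L (psrc p) == i) && (ptgt (plift F (L (psrc p)) p) == j).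
rewrite -[RHS](linext_filter_coef c); congr (mcoeff p).
move: x; apply: pathalg_ext => [a x y|a x y|q].
- by rewrite /lift_pathalg !linearP.
- exact: linext_linear.
rewrite lift_pathalg_pbasis entry_pbasis psrc_plift ?FL // map_plift ?FL //.
exact/esym/linextU.
Qed.

(** If some path p of r contributes to the (i, j) entry of the lift of r,
    then p also occurs in the component of r from F(i) to F(j).  The condition
    on components makes that component an entry of the lift, at a place that p
    forces to be (i, j); and a component of r lies in the ideal. *)
Lemma entry_rel r' i j : rho' r' -> pi (entry i j r') = 0.
Proof.
move=> rr'; have /(rc_lift covF)[L [r [FL rr e]]] := rr'.
have [i' [j' eij']] := rc_component covF (fvert F i) (fvert F j) rr'.
have er : entry i' j' r' = component (fvert F i) (fvert F j) r.
  apply: etrans (entryE F i' j' r') (etrans eij' _).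
  by rewrite e; congr component; exact: map_lift_pathalg.
have [[p /eqP pr]|nex] :=
  pselect (exists p, (entry i j r' : {malg K[qpath Q]})@_p <> 0); last first.
  suff -> : entry i j r' = 0 by exact: qpi0.
  apply/malgP => p; rewrite mcoeff0; apply: contrapT => np; apply: nex.
  by exists p.
have : (entry i' j' r' : {malg K[qpath Q]})@_p != 0.
  rewrite er /component linext_filter_coef.
  move: pr; rewrite e entry_lift_coef //; case: ifP; last by rewrite eqxx.
  case/andP=> /eqP Li /eqP tj rp.
  have pL : psrc p = fvert F (L (psrc p)) by rewrite FL.
  by rewrite -(ptgt_plift cov pL) tj -Li FL !eqxx.
move: pr; rewrite e !entry_lift_coef //.
case: ifP => [/andP[/eqP <- /eqP <-]|]; last by rewrite eqxx.
case: ifP => [/andP[/eqP ei /eqP ej]|]; last by rewrite eqxx.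
move=> _ _; move: er; rewrite -ei -ej -e => ->.
by rewrite component_mul !qpiM (gen_ideal_sub rr) mulr0 mul0r.
Qed.

(** All entries are treated at once, since the entries of a product
    involve all rows and columns. *)
Lemma entry_ideal i j (x : KQ') : pi' x = 0 -> pi (entry i j x) = 0.
Proof.
pose T (x : KQ') := forall i j, pi (entry i j x) = 0.
have T0 : T 0 by move=> i1 j1; rewrite linear0 qpi0.
have TD (y z : KQ') : T y -> T z -> T (y + z).
  by move=> Ty Tz i1 j1; rewrite linearD qpiD Ty Tz addr0.
have Tl (y z : KQ') : T z -> T (y * z).
  by move=> Tz i1 j1; rewrite entryM qpi_sum big1 // => k _; rewrite qpiM Tz mulr0.
have Tr (y z : KQ') : T z -> T (z * y).
  by move=> Tz i1 j1; rewrite entryM qpi_sum big1 // => k _; rewrite qpiM Tz mul0r.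
move=> x0; apply: (@gen_ideal_ind _ _ _ (Ideal2 T0 TD Tl Tr) _ x x0) => r rr i1 j1.
exact: entry_rel.
Qed.

Definition liftA : A -> A' := quot_lift (fun x => pi' (lift x)).
Definition entryA (a : A') i j : A := quot_lift (fun x => pi (entry i j x)) a.

Lemma liftAE x : liftA (pi x) = pi' (lift x).
Proof.
rewrite qpiE; apply: quot_liftE => [y z|y Iy]; first by rewrite linearB qpiB.
by apply: total_lift_ideal; apply/qpi0P.
Qed.

Lemma entryAE x i j : entryA (pi' x) i j = pi (entry i j x).
Proof.
rewrite qpiE; apply: quot_liftE => [y z|y Iy]; first by rewrite linearB qpiB.
by apply: entry_ideal; apply/qpi0P.
Qed.

Fact liftA_zmod : zmod_morphism liftA.
Proof.
move=> a b; have [x <-] := qpi_surj a; have [y <-] := qpi_surj b.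
by rewrite -qpiB !liftAE linearB qpiB.
Qed.
HB.instance Definition _ := GRing.isZmodMorphism.Build A A' liftA liftA_zmod.
Fact liftA_monoid : monoid_morphism liftA.
Proof.
split=> [|a b]; first by rewrite -(qpi1 rho) liftAE (total_lift1 K cov) qpi1.
have [x <-] := qpi_surj a; have [y <-] := qpi_surj b.
by rewrite -qpiM !liftAE (total_liftM cov) qpiM.
Qed.
HB.instance Definition _ := GRing.isMonoidMorphism.Build A A' liftA liftA_monoid.

Definition idemA i : A := pi (pb (ptriv (fvert F i))).
Definition unitA i : A' := pi' (pb (ptriv i)).

Fact entryAD (a b : A') i j : entryA (a + b) i j = entryA a i j + entryA b i j.
Proof.
have [x <-] := qpi_surj a; have [y <-] := qpi_surj b.
by rewrite -qpiD !entryAE linearD qpiD.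
Qed.
Fact entryAM (a b : A') i j :
  entryA (a * b) i j = \sum_k entryA a i k * entryA b k j.
Proof.
have [x <-] := qpi_surj a; have [y <-] := qpi_surj b.
rewrite -qpiM entryAE entryM qpi_sum; apply: eq_bigr => k _.
by rewrite !entryAE qpiM.
Qed.
Fact entryA1 i j : entryA 1 i j = if i == j then idemA i else 0.
Proof. by rewrite -(qpi1 rho') entryAE entry1; case: eqP => // _; exact: qpi0. Qed.
Fact entryA_unit i j k :
  entryA (unitA i) j k = if (j == i) && (k == i) then idemA i else 0.
Proof. by rewrite entryAE entry_ptriv; case: ifP => // _; exact: qpi0. Qed.
Fact entryA_row_sum a i : \sum_j entryA (liftA a) i j = idemA i * a.
Proof.
have [x <-] := qpi_surj a; rewrite liftAE -qpiM -(entry_row_sum cov) qpi_sum.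
by apply: eq_bigr => j _; rewrite entryAE.
Qed.
Fact liftA_col_sum (a : A') j :
  \sum_i unitA i * liftA (entryA a i j) = a * unitA j.
Proof.
have [x <-] := qpi_surj a; rewrite -qpiM -(lift_entry_col_sum cov) qpi_sum.
by apply: eq_bigr => i _; rewrite entryAE liftAE qpiM.
Qed.

Definition covering_transfer : transfer A A' :=
  @Transfer A A' (vert Q') idemA unitA liftA entryA
    entryAD entryAM entryA1 entryA_unit entryA_row_sum liftA_col_sum.
Notation D := covering_transfer.

(** A path p' is the idempotent of its initial vertex times the transfer
    of its push-down. *)
Lemma vanish_lift N : vanish_from rho N -> vanish_from rho' N.
Proof.
move=> vN p; rewrite -(plen_map_path F) => /vN /total_lift_ideal p0.
have := ptriv_total_lift K cov (psrc p) (map_path F p).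
rewrite eqxx (plift_uniq cov (erefl _) (erefl _)) => <-.
by rewrite qpiM p0 mulr0.
Qed.

Lemma augA_entryA v (a : A') i j : augA v (entryA a i j) =
  if (i == j) && (fvert F i == v) then augA i a else 0.
Proof.
have [x <-] := qpi_surj a.
by rewrite entryAE (augAE rho2) (augAE rho2') aug_entry.
Qed.

Lemma augA_liftA i a : augA i (liftA a) = augA (fvert F i) a.
Proof.
have [x <-] := qpi_surj a.
by rewrite liftAE (augAE rho2) (augAE rho2') aug_total_lift.
Qed.

Section Semisimple.
Variable N : nat.
Hypothesis vN : vanish_from rho N.
Notation J := (jacobson A).
Notation J' := (jacobson A').

Lemma quotJ0 (a : A^o) : (forall v, augA v a = 0) -> quotpi J a = 0.
Proof.
move=> a0; rewrite -(linear0 (quotpi J)); apply/quotpi_eq; rewrite subr0.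
exact/(in_jacobsonP rho2 a vN).
Qed.

Lemma semisimple_offdiag (a : A') i j (s : quotmod J) :
  i != j -> tr_ent (t := D) a i j *: s = 0.
Proof.
move=> ij; have [b <-] := quotpi_surj s; rewrite -quotpiZ; apply: quotJ0 => v.
by rewrite (augAM rho2) augA_entryA (negPf ij) mul0r.
Qed.

Lemma semisimple_diag (i : tr_ix D) (a : A) (s : quotmod J) :
  tr_idem i *: (a *: s) = a *: (tr_idem i *: s).
Proof.
have [b <-] := quotpi_surj s; rewrite -!quotpiZ.
apply/eqP; rewrite -subr_eq0 -linearB; apply/eqP; apply: quotJ0 => v.
have augM3 (x y z : A) : augA v (x * (y * z)) =
    augA v x * (augA v y * augA v z).
  by rewrite (augAM rho2) (augAM rho2).
rewrite (augAD rho2) (augAN rho2); apply/eqP; rewrite subr_eq0; apply/eqP.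
exact: etrans (augM3 _ _ _) (etrans (mulrCA _ _ _) (esym (augM3 _ _ _))).
Qed.

(** The two maps are induced by the universal properties of the quotients:
    the transpose of the map A/J -> A'/J' given by the transfer, and the map that
    sends 1 to the image under [pull_eta] of 1. *)
Lemma pullup_semisimple : exists (iso : {linear pullup D (quotmod J) -> quotmod J'})
    (iso_inv : {linear quotmod J' -> pullup D (quotmod J)}),
  cancel iso iso_inv /\ cancel iso_inv iso.
Proof.
pose one : quotmod J := quotpi J (1 : A^o).
pose one' : quotmod J' := quotpi J' (1 : A'^o).
have oneE (a : A^o) : quotpi J a = a *: one by rewrite -quotpiZ -[in LHS](mulr1 a).
have oneE' (a : A'^o) : quotpi J' a = a *: one'.
  by rewrite -quotpiZ -[in LHS](mulr1 a).
pose f0 (a : A^o) : restrict_mod (tr_map D) (quotmod J') := quotpi J' (liftA a).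
have lf0 : linear f0.
  by move=> c a b; rewrite /f0 rmorphD rmorphM quotpiD restrictZ -quotpiZ.
pose f0' : {linear A^o -> restrict_mod (tr_map D) (quotmod J')} :=
  HB.pack f0 (GRing.isLinear.Build A _ _ _ f0 lf0).
have [|g gE] := @quotmod_lift _ _ _ J f0'.
  move=> a /(in_jacobsonP rho2 a vN) a0; rewrite /= /f0.
  rewrite -(linear0 (quotpi J')); apply/quotpi_eq; rewrite subr0.
  apply/(in_jacobsonP rho2' _ (vanish_lift vN)) => i.
  by rewrite augA_liftA.
pose f1 (a : A'^o) : pullup D (quotmod J) := a *: pull_eta D one.
have lf1 : linear f1 by move=> c a b; rewrite /f1 scalerDl scalerA.
pose f1' : {linear A'^o -> pullup D (quotmod J)} :=
  HB.pack f1 (GRing.isLinear.Build A' _ _ _ f1 lf1).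
have [|h hE] := @quotmod_lift _ _ _ J' f1'.
  move=> a /(in_jacobsonP rho2' a (vanish_lift vN)) a0; rewrite /= /f1.
  apply: pullP => i; rewrite pullZ pull0 big1 // => j _.
  rewrite pull_etaE scalerA tr_ent_r -quotpiZ; apply: quotJ0 => v.
  by rewrite (augAM rho2) augA_entryA a0 if_same mul0r.
exists (adj_up g), h; split=> [s|s'].
  rewrite [s in RHS]pull_sumE /= /adj_up linear_sum; apply: eq_bigr => i _.
  rewrite linearZ_LR; congr (_ *: _); have [b <-] := quotpi_surj (s i).
  by rewrite gE /= /f0 hE /= /f1 oneE pull_etaZ.
have [a <-] := quotpi_surj s'; rewrite hE /= /f1 -/(adj_up g) linearZ_LR oneE'.
congr (_ *: _); rewrite /= /adj_up.
have -> : one' = \sum_i unitA i *: one'.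
  by rewrite -scaler_suml -qpi_sum -[X in X *: _]/(pi' 1) qpi1 scale1r.
apply: eq_bigr => i _; rewrite pull_etaE -oneE gE /= /f0 oneE' scalerA.
by rewrite (tr_unitK (D := D)).
Qed.

End Semisimple.
End RelationCovering.

Theorem theorem4 (K : fieldType) (Q Q' : quiver)
    (rho : pathalg K Q -> Prop) (rho' : pathalg K Q' -> Prop)
    (F : qmorphism Q' Q) :
  quadratic rho ->
  connected Q ->
  finite_dimensional (quiver_alg rho) ->
  koszul (@length_grading K Q rho) ->
  relation_covering rho' rho F ->
  (forall p : nat, p \in [pchar K]%R -> ~~ (p %| #|deck_group F|)%N) ->
  koszul (@length_grading K Q' rho').
Proof.
move=> rho2 _ fdA [_ [_ [P genP]]] covF _.
have [N vN] := vanish_from_findim rho2 fdA.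
have rho2' := quadratic_lift covF rho2.
have fdA' := findim_vanish_from (vanish_lift covF vN).
have [_ [Q'0 _] _] := rc_regular covF.
split; first exact: quadratic_graded_quiver_algebra.
split=> //; have [iso [inv [isoK invK]]] := pullup_semisimple covF rho2 vN.
exists (pull_resolution P isoK invK).
have offdiag := semisimple_offdiag covF rho2 vN.
have diag := @semisimple_diag _ _ _ _ _ _ covF rho2 _ vN.
move=> n f n2 cf.
exact (@pull_ext_generated _ _ _ _ _ P iso inv isoK invK offdiag diag genP
  n f n2 cf).
Qed.
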